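(* Unless $\mathsf{NP}\subseteq\mathsf{coNP}/\mathsf{poly}$, there is no polynomial-time algorithm which takes as input an instance $\mathcal{I}$ of $\textsc{BNSL}^{\neq 0}$ whose superstructure graph has local feedback edge number $k$ and outputs an equivalent instance $\mathcal{I}'=(V',\mathcal{F}',\ell')$ of $\textsc{BNSL}^{\neq 0}$ such that $|V'|\in k^{O(1)}$. In particular, $\textsc{BNSL}^{\neq 0}$ does not admit a polynomial kernel when parameterized by the local feedback edge number of the superstructure graph.
   Context: Let $V$ be a finite set and $\mathcal{F}=\{f_v:2^{V\setminus\{v\}}\to\mathbb{N}_0 : v\in V\}$. For a digraph $D=(V,A)$ let $P_D(v)=\{u:uv\in A\}$ and $\texttt{score}(D)=\sum_v f_v(P_D(v))$. BNSL: given $V$, $\mathcal{F}$ and an integer $\ell$, decide whether there is an acyclic digraph $D$ on $V$ with $\texttt{score}(D)\geq\ell$ (a solution). In $\textsc{BNSL}^{\neq 0}$, $\mathcal{F}$ is given in the non-zero representation: for each $v$ the collection $\Gamma_f(v)=\{Z:f_v(Z)\neq 0\}$ with its values; input size $|V|+\ell+\sum_{v,P\in\Gamma_f(v)}|P|$. With $P_\to(v)=\bigcup_{Z\in\Gamma_f(v)}Z$, the superstructure graph $G=(V,E)$ has $ab\in E$ iff $a\in P_\to(b)$ or $b\in P_\to(a)$. For a connected graph $G$, spanning tree $T$ and $v\in V(G)$, $E_{\operatorname{loc}}^T(v)=\{uw\in E(G)\setminus E(T): \text{the } u\text{–}w \text{ path in } T \text{ contains } v\}$, $\operatorname{lfen}(G,T)=\max_v|E^T_{\operatorname{loc}}(v)|$,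 $\operatorname{lfen}(G)=\min_T\operatorname{lfen}(G,T)$; for disconnected graphs the maximum over components is taken. Two instances are equivalent if both are yes- or both are no-instances and a solution of one can be transformed into one of the other in polynomial time. A polynomial kernel is a polynomial-time algorithm producing an equivalent instance of size polynomial in the parameter. *)

(* Defs.v *)
From HB Require Import structures.
From mathcomp Require Import all_boot all_order all_algebra.

Set Implicit Arguments.
Unset Strict Implicit.
Unset Printing Implicit Defensive.

(** * Computation: deterministic multi-tape Turing machines *)

Definition bits := seq bool.

(* [None] is the blank; the bits are the input/output alphabet and [G] holds
   the additional work symbols. *)
Definition symb (G : finType) := option (bool + G).

Variant move := MoveL | Stay | MoveR.

(* A two-way infinite tape: the cells left of the head, nearest first, and the
   cells from the head rightwards; all other cells are blank. *)
Definition tape (G : finType) := (seq (symb G) * seq (symb G))%type.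

Definition tape_read (G : finType) (t : tape G) : symb G := head None t.2.

Definition tape_upd (G : finType) (t : tape G) (am : symb G * move) : tape G :=
  let: (a, m) := am in
  let l := t.1 in
  let r := behead t.2 in
  match m with
  | MoveL => (behead l, head None l :: a :: r)
  | Stay => (l, a :: r)
  | MoveR => (a :: l, r)
  end.

(* The machine has [tm_tapes.+1] tapes and halts when [tm_delta] is [None]. *)
Record tm := TM {
  tm_state : finType;
  tm_work : finType;
  tm_tapes : nat;
  tm_start : tm_state;
  tm_delta : tm_state -> {ffun 'I_tm_tapes.+1 -> symb tm_work} ->
    option (tm_state * ('I_tm_tapes.+1 -> symb tm_work * move))
}.

Definition config (M : tm) :=
  (tm_state M * ('I_(tm_tapes M).+1 -> tape (tm_work M)))%type.

Definition tm_next (M : tm) (c : config M) :=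
  tm_delta c.1 [ffun i => tape_read (c.2 i)].

Definition tm_step (M : tm) (c : config M) : config M :=
  if tm_next c is Some (q, acts) then (q, fun i => tape_upd (c.2 i) (acts i))
  else c.

Definition tm_halted (M : tm) (c : config M) : bool := ~~ isSome (tm_next c).

(* The input is on tape 0, with the head on its first bit. *)
Definition tm_init (M : tm) (x : bits) : config M :=
  (tm_start M,
   fun i => ([::], if i == ord0 then [seq Some (inl b) | b <- x] else [::])).

Fixpoint read_bits (G : finType) (s : seq (symb G)) : bits :=
  if s is Some (inl b) :: s' then b :: read_bits s' else [::].

(* The output is on the last tape, from the head up to the first non-bit. *)
Definition tm_output (M : tm) (c : config M) : bits :=
  read_bits (c.2 ord_max).2.

(* Halted configurations are fixed by [tm_step], so this says that [M] halts
   on [x] after at most [n] steps. *)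
Definition tm_computes_in (M : tm) (x : bits) (n : nat) (y : bits) : Prop :=
  let c := iter n (@tm_step M) (tm_init M x) in
  tm_halted c /\ tm_output c = y.

(* Every polynomial in [n] is bounded by [n ^ c + c] for some [c], including
   at [n = 0] and [n = 1]. *)
Definition poly_bound (c n : nat) : nat := n ^ c + c.

(* The map sending [ein a] to [eout a] is computable in polynomial time on the
   inputs [ein a] with [P a]. *)
Definition poly_time (A : Type) (P : A -> Prop) (ein eout : A -> bits) : Prop :=
  exists (M : tm) (c : nat), forall a : A, P a ->
    tm_computes_in M (ein a) (poly_bound c (size (ein a))) (eout a).

(** * Encodings *)

(* Self-delimiting: each bit of [x] is preceded by [true], then [false]. *)
Definition bpair (x y : bits) : bits :=
  flatten [seq [:: true; b] | b <- x] ++ false :: y.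

Definition enc_seq (s : seq bits) : bits := foldr bpair [::] s.

Definition enc_unary (n : nat) : bits := nseq n true.

(* Binary, least significant bit first. *)
Definition enc_binary (n : nat) : bits :=
  mkseq (fun i => odd (n %/ 2 ^ i)) (trunc_log 2 n).+1.

Definition enc_int_unary (z : int) : bits :=
  (z < 0)%R :: enc_unary `|z|%N.

(** * Complexity classes *)

Definition language := bits -> Prop.

Definition in_NP (L : language) : Prop :=
  exists (V : bits -> bits -> bool) (c : nat),
    poly_time (fun _ : bits * bits => True)
      (fun xy => bpair xy.1 xy.2) (fun xy => [:: V xy.1 xy.2]) /\
    forall x, L x <-> exists y, size y <= poly_bound c (size x) /\ V x y.

Definition in_coNP (L : language) : Prop := in_NP (fun x => ~ L x).

Definition in_slash_poly (C : language -> Prop) (L : language) : Prop :=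
  exists (L' : language) (adv : nat -> bits) (c : nat),
    [/\ C L',
        forall n, size (adv n) <= poly_bound c n &
        forall x, L x <-> L' (bpair x (adv (size x)))].

Definition NP_sub_coNP_poly : Prop :=
  forall L : language, in_NP L -> in_slash_poly in_coNP L.

(** * Local feedback edge number *)

Section Graphs.
Variable V : finType.

(* A graph is given by its set of edges, each a two-element set of vertices. *)
Implicit Types (E F : {set {set V}}) (C : {set V}).

Definition adj E : rel V := fun x y => [set x; y] \in E.

Definition forest F : bool :=
  ~~ [exists p : #|V|.-bseq V, [&& 2 < size p, cycle (adj F) p & uniq p]].

(* [F] is the edge set of a spanning tree of the graph [(C, E)]. *)
Definition spanning_tree C E F : bool :=
  [&& F \subset E,
      [forall x in C, forall y in C, connect (adj F) x y] &
      forest F].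

(* [v] lies on a (hence, when [F] is a tree, on the) [u]-[w] path of [F]. *)
Definition on_path F (u w v : V) : bool :=
  [exists p : #|V|.-bseq V,
    [&& path (adj F) u p, last u p == w, uniq (u :: p) & v \in u :: p]].

Definition Eloc E F (v : V) : {set {set V}} :=
  [set e in E :\: F |
    [exists u, exists w, (e == [set u; w]) && on_path F u w v]].

Definition lfen_tree C E F : nat := \max_(v in C) #|Eloc E F v|.

(* For a connected graph [(C, E)]. The default value [#|E|] is at least every
   [lfen_tree C E F], so it does not affect the minimum. *)
Definition lfen_connected C E : nat :=
  \big[minn/#|E|]_(F | spanning_tree C E F) lfen_tree C E F.

Definition component E (x : V) : {set V} := [set y | connect (adj E) x y].

Definition lfen E : nat :=
  \max_(x : V)
    lfen_connected (component E x) [set e in E | e \subset component E x].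

End Graphs.

(** * Bayesian network structure learning, non-zero representation *)

(* The vertex set is ['I_nv]; [entries v] lists the pairs [(Z, f_v(Z))] with
   [f_v(Z) != 0]. *)
Record bnsl := BNSL {
  nv : nat;
  entries : 'I_nv -> seq ({set 'I_nv} * nat);
  ell : int;
  entries_uniq : forall v, uniq (unzip1 (entries v));
  entries_wf : forall v Z k, (Z, k) \in entries v -> v \notin Z /\ k != 0
}.

Section BNSL.
Variable I : bnsl.
Local Notation V := 'I_(nv I).

(* At most one entry has first component [Z]. *)
Definition fscore (v : V) (Z : {set V}) : nat :=
  \sum_(e <- entries v | e.1 == Z) e.2.

Definition Gam (v : V) : {set {set V}} := [set Z | fscore v Z != 0].

Definition Pto (v : V) : {set V} := \bigcup_(Z in Gam v) Z.

Definition superstructure : {set {set V}} :=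
  [set [set ab.1; ab.2] |
    ab : V * V & (ab.1 \in Pto ab.2) || (ab.2 \in Pto ab.1)].

Definition bnsl_size : nat :=
  nv I + `|ell I|%N + \sum_(v : V) \sum_(P in Gam v) #|P|.

(* A digraph on the vertices of the instance is its set of arcs. *)
Definition digraph := {set V * V}.

Definition parents (D : digraph) (v : V) : {set V} := [set u | (u, v) \in D].

Definition acyclic (D : digraph) : Prop :=
  forall p : seq V, p <> [::] -> ~ ucycle (fun u v => (u, v) \in D) p.

Definition score (D : digraph) : nat := \sum_(v : V) fscore v (parents D v).

Definition solution (D : digraph) : Prop :=
  acyclic D /\ (ell I <= (score D)%:Z)%R.

Definition yes_instance : Prop := exists D, solution D.

Definition enc_vset (Z : {set V}) : bits :=
  enc_seq [seq enc_unary (val i) | i <- enum Z].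

(* The threshold is in unary, matching its contribution to [bnsl_size]. *)
Definition enc_bnsl : bits :=
  enc_seq [:: enc_unary (nv I);
              enc_int_unary (ell I);
              enc_seq [seq enc_seq [seq bpair (enc_vset e.1) (enc_binary e.2)
                                   | e <- entries v] | v <- enum V]].

(* The adjacency matrix. *)
Definition enc_digraph (D : digraph) : bits :=
  [seq (u, v) \in D | u <- enum V, v <- enum V].

End BNSL.

(** * Equivalence-preserving algorithms and kernels *)

(* The transformations receive the original instance with the solution, so
   their running time is polynomial in the size of the instance. *)
Definition forward_transformable (R : bnsl -> bnsl) : Prop :=
  exists T : forall I, digraph I -> digraph (R I),
    poly_time (fun a : {I : bnsl & digraph I} => solution (projT2 a))
      (fun a => bpair (enc_bnsl (projT1 a)) (enc_digraph (projT2 a)))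
      (fun a => enc_digraph (T (projT1 a) (projT2 a))) /\
    forall I D, solution D -> solution (T I D).

Definition backward_transformable (R : bnsl -> bnsl) : Prop :=
  exists T : forall I, digraph (R I) -> digraph I,
    poly_time (fun a : {I : bnsl & digraph (R I)} => solution (projT2 a))
      (fun a => bpair (enc_bnsl (projT1 a)) (enc_digraph (projT2 a)))
      (fun a => enc_digraph (T (projT1 a) (projT2 a))) /\
    forall I D, solution D -> solution (T I D).

Definition outputs_equivalent (R : bnsl -> bnsl) : Prop :=
  [/\ forall I, yes_instance I <-> yes_instance (R I),
      forward_transformable R &
      backward_transformable R].

Definition poly_time_bnsl (R : bnsl -> bnsl) : Prop :=
  poly_time (fun _ : bnsl => True) enc_bnsl (fun I => enc_bnsl (R I)).

Definition polynomial_kernel (param : bnsl -> nat) (R : bnsl -> bnsl) : Prop :=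
  [/\ poly_time_bnsl R,
      outputs_equivalent R &
      exists c, forall I, bnsl_size (R I) <= poly_bound c (param I)].

Definition lfen_superstructure (I : bnsl) : nat := lfen (superstructure I).

(* Main.v *)
From Stdlib Require Import Classical ClassicalEpsilon.
From mathcomp Require Import all_boot all_order all_algebra.
From mathcomp Require Import zify.
Require Import Defs.

Set Implicit Arguments.
Unset Strict Implicit.
Unset Printing Implicit Defensive.

(* Such an algorithm would put NP into P/poly.  Fix L in NP and a length n.
   From a pair of strings of length n, at least one of them in L, a circuit with
   a selector bit and a witness as free inputs expresses that the selected
   string is in L, and the satisfiability of this circuit becomes a structure
   learning gadget.  The disjoint union of t gadgets has a local feedback edge
   number that does not depend on t, so for t large its solutions, which select
   one string of each pair, are mapped forward to digraphs on so few vertices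
   that there are at most 2^(t-1) of them.  Going forward and backward hence
   changes, for at least half of the selection patterns, the string selected in
   some pair: the round trip produces evidence for a string of L whose witness
   was not put in.  Double counting shows that fixing everything but this string yields a test,
   sound for L, that succeeds on a 1/(2t) fraction of any given subset of L, so
   polynomially many tests cover all strings of L of length n.  Each test is a
   polynomial-size circuit, because circuits simulate Turing machines; a CNF
   refuting the resulting circuit is the advice. *)

(** * Polynomially bounded functions *)

(** A solution of the union can be built only from a witness for the selected string of every block.
    The string under test therefore sits in an unselected slot: the solution fed into the round trip
    needs no witness for it, while any solution that comes back certifies the string selected in
    each block. A test can thus err only by rejecting. Two features keep the size polynomial. The
    local feedback edge number is a maximum over components, so adding copies does not change the
    bound on the parameter, nor that on the number of vertices of the output. And the strings enter
    an instance only through nonzero weights, so its superstructure graph and the layout of its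
    encoding are fixed in advance. In the fraction [1/(2t)], one factor accounts for the half of the
    selection patterns that may survive, the other for the choice of one of [t] positions. *)

Definition polybounded (f : nat -> nat) := exists c, forall n, f n <= poly_bound c n.

Lemma leq_expr m n c : m <= n -> m ^ c <= n ^ c.
Proof. by case: c => // c h; rewrite leq_exp2r. Qed.

(** Powers of [n + 2] multiply by adding exponents and, the base being at least 2, absorb constants
    even at 0 and 1; closure under sums and products becomes short. *)
Lemma polyboundedP f :
  polybounded f <-> exists c, forall n, f n <= (n + 2) ^ c.
Proof.
split=> -[c Hc].
  exists c.+1 => n; apply: leq_trans (Hc n) _.
  rewrite /poly_bound expnS.
  have h1 : n ^ c <= (n + 2) ^ c by apply/leq_expr/leq_addr.
  have h2 : c <= (n + 2) ^ c.
    by apply: ltnW; apply: ltn_expl; rewrite addn2.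
  nia.
(* For [n >= 2], [n + 2 <= n ^ 2] explains the exponent [2 * c]; for [n <= 1] the additive [3 ^ c]
   suffices. *)
exists (2 * c + 3 ^ c) => n; apply: leq_trans (Hc n) _.
rewrite /poly_bound.
case: (leqP 2 n) => hn.
  apply: leq_trans (leq_addr _ _).
  apply: (@leq_trans (n ^ (2 * c))); last by rewrite leq_pexp2l ?leq_addr //; lia.
  by rewrite expnM; apply: leq_expr; rewrite -mulnn; nia.
apply: leq_trans (leq_addl _ _); apply: leq_trans (leq_addl _ _).
by apply: leq_expr; lia.
Qed.

Lemma polybounded_le f g : (forall n, f n <= g n) -> polybounded g -> polybounded f.
Proof. by move=> h [c Hc]; exists c => n; apply: leq_trans (h n) (Hc n). Qed.

Lemma polybounded_cst c : polybounded (fun=> c).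
Proof. by exists c => n; rewrite /poly_bound leq_addl. Qed.

Lemma polybounded_id : polybounded id.
Proof. by exists 1 => n; rewrite /poly_bound expn1 leq_addr. Qed.

Lemma polyboundedD f g :
  polybounded f -> polybounded g -> polybounded (fun n => f n + g n).
Proof.
move=> /polyboundedP[a Ha] /polyboundedP[b Hb]; apply/polyboundedP.
exists (a + b).+1 => n; have := Ha n; have := Hb n.
have p1 : 0 < (n + 2) ^ a by rewrite expn_gt0 addn2.
have p2 : 0 < (n + 2) ^ b by rewrite expn_gt0 addn2.
rewrite expnS expnD; nia.
Qed.

Lemma polyboundedM f g :
  polybounded f -> polybounded g -> polybounded (fun n => f n * g n).
Proof.
move=> /polyboundedP[a Ha] /polyboundedP[b Hb]; apply/polyboundedP.
by exists (a + b) => n; rewrite expnD leq_mul.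
Qed.

Lemma polyboundedX f k : polybounded f -> polybounded (fun n => f n ^ k).
Proof.
move=> hf; elim: k => [|k IH]; first exact: polybounded_cst.
by apply: polybounded_le (polyboundedM hf IH) => n; rewrite expnS.
Qed.

Lemma polybounded_pb f c :
  polybounded f -> polybounded (fun n => poly_bound c (f n)).
Proof.
by move=> hf; apply: polyboundedD (polyboundedX _ hf) (polybounded_cst c).
Qed.

Lemma poly_bound_mono c m n : m <= n -> poly_bound c m <= poly_bound c n.
Proof.
by move=> h; rewrite /poly_bound leq_add2r leq_expr.
Qed.

(** * Circuits *)

Definition gate (W : Type) := (bool + W * W)%type.

Definition geval W (g : gate W) (val : W -> bool) : bool :=
  match g with inl b => b | inr (w1, w2) => ~~ (val w1 && val w2) end.

Definition gmap W W' (f : W -> W') (g : gate W) : gate W' :=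
  match g with inl b => inl b | inr (w1, w2) => inr (f w1, f w2) end.

Lemma geval_gmap W W' (f : W -> W') g val :
  geval (gmap f g) val = geval g (val \o f).
Proof. by case: g => [b|[w1 w2]]. Qed.

Lemma eq_geval W (g : gate W) val val' : val =1 val' -> geval g val = geval g val'.
Proof. by case: g => [b|[w1 w2]] //= h; rewrite !h. Qed.

Definition wval I G (x : I -> bool) (v : G -> bool) (w : I + G) : bool :=
  match w with inl i => x i | inr k => v k end.

Definition consistent I G (g : G -> gate (I + G)) (x : I -> bool) (v : G -> bool) :=
  forall k, v k = geval (g k) (wval x v).

(* The family [b] of Boolean functions on [X] is computed from the family [a]
   by [s] gates.  Instead of ordering the gates topologically, we require that
   the gate equations have a unique solution, which makes circuits closed under
   composition without any index arithmetic. *)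
Definition comp X I J (a : I -> X -> bool) (b : J -> X -> bool) (s : nat) :=
  exists (G : finType) (g : G -> gate (I + G)) (o : J -> I + G) (v : G -> X -> bool),
  [/\ #|G| <= s,
      forall x, consistent g (a^~ x) (v^~ x),
      forall x v', consistent g (a^~ x) v' -> v' =1 v^~ x &
      forall j x, b j x = wval (a^~ x) (v^~ x) (o j)].

Lemma comp_le X I J (a : I -> X -> bool) (b : J -> X -> bool) s s' :
  s <= s' -> comp a b s -> comp a b s'.
Proof.
move=> h [G [g [o [v [h1 h2 h3 h4]]]]].
by exists G, g, o, v; split=> //; apply: leq_trans h1 h.
Qed.

Lemma comp_sub X I J J' (a : I -> X -> bool) (b : J -> X -> bool)
    (b' : J' -> X -> bool) (p : J' -> J) s :
  (forall j x, b' j x = b (p j) x) -> comp a b s -> comp a b' s.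
Proof.
move=> hb [G [g [o [v [h1 h2 h3 h4]]]]].
by exists G, g, (o \o p), v; split=> // j x; rewrite hb h4.
Qed.

Lemma comp_pre X Y I J (a : I -> X -> bool) (b : J -> X -> bool) (p : Y -> X) s :
  comp a b s -> comp (fun i y => a i (p y)) (fun j y => b j (p y)) s.
Proof.
move=> [G [g [o [v [h1 h2 h3 h4]]]]].
exists G, g, o, (fun k y => v k (p y)); split=> // y v'; exact: h3.
Qed.

Lemma comp_proj X I J (a : I -> X -> bool) (b : J -> X -> bool) (p : J -> I) :
  (forall j x, b j x = a (p j) x) -> comp a b 0.
Proof.
move=> hb; exists void, (fun k : void => match k with end), (fun j => inl (p j)).
exists (fun k : void => match k with end); split=> //; first by rewrite card_void.
by move=> x [].
by move=> x v' _ [].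
Qed.

(** One gate per truth value serves all outputs, so the cost does not grow with [J]. *)
Lemma comp_cst X I J (a : I -> X -> bool) (b : J -> X -> bool) (p : J -> bool) :
  (forall j x, b j x = p j) -> comp a b 2.
Proof.
move=> hb; exists bool, (fun k => inl k), (fun j => inr (p j)), (fun k _ => k).
by split=> //; rewrite card_bool.
Qed.

Lemma comp_nand X I J (a : I -> X -> bool) (b : J -> X -> bool) (i j : I) :
  (forall k x, b k x = ~~ (a i x && a j x)) -> comp a b 1.
Proof.
move=> hb; exists unit, (fun=> inr (inl i, inl j)), (fun=> inr tt).
exists (fun k x => ~~ (a i x && a j x)); by split=> //; rewrite card_unit.
Qed.

(** Uniqueness survives composition: the equations of the first circuit do not mention the gates of
    the second, so they determine their own values, which then fix the inputs of the second. *)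
Lemma comp_trans X I J K (a : I -> X -> bool) (b : J -> X -> bool)
    (c : K -> X -> bool) s s' :
  comp a b s -> comp b c s' -> comp a c (s + s').
Proof.
move=> [G1 [g1 [o1 [v1 [h1 h2 h3 h4]]]]] [G2 [g2 [o2 [v2 [k1 k2 k3 k4]]]]].
pose r1 (w : I + G1) : I + (G1 + G2) :=
  match w with inl i => inl i | inr k => inr (inl k) end.
pose r2 (w : J + G2) : I + (G1 + G2) :=
  match w with inl j => r1 (o1 j) | inr k => inr (inr k) end.
pose v (k : G1 + G2) x := match k with inl k => v1 k x | inr k => v2 k x end.
exists (G1 + G2)%type, (fun k => match k with inl k => gmap r1 (g1 k)
  | inr k => gmap r2 (g2 k) end), (r2 \o o2), v.
have w1 x : wval (a^~ x) (v^~ x) \o r1 =1 wval (a^~ x) (v1^~ x) by case.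
have w2 x : wval (a^~ x) (v^~ x) \o r2 =1 wval (b^~ x) (v2^~ x).
  by case=> [j|k] //=; rewrite -[LHS]/((wval (a^~ x) (v^~ x) \o r1) (o1 j)) w1 h4.
split.
- by rewrite card_sum leq_add.
- by move=> x [k|k]; rewrite geval_gmap; [rewrite (eq_geval _ (w1 x)); apply: h2
    | rewrite (eq_geval _ (w2 x)); apply: k2].
- move=> x v' hv.
  have e1 : v' \o inl =1 v1^~ x.
    apply: h3 => k /=; rewrite hv geval_gmap; apply: eq_geval.
    by case.
  have e2 : v' \o inr =1 v2^~ x.
    apply: k3 => k /=; rewrite hv geval_gmap; apply: eq_geval.
    case=> [j|k'] //=; rewrite h4; by case: (o1 j).
  by case=> k; [apply: (e1 k) | apply: (e2 k)].
by move=> k x; rewrite k4 -w2.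
Qed.

Lemma comp_sig X I (T : finType) (J : T -> Type) (a : I -> X -> bool)
    (b : forall t, J t -> X -> bool) (s : T -> nat) :
  (forall t, comp a (b t) (s t)) ->
  comp a (fun p : {t : T & J t} => b (tag p) (tagged p)) (\sum_t s t).
Proof.
move=> /fin_all_exists[G] /fin_all_exists[g] /fin_all_exists[o] /fin_all_exists[v] H.
pose r t (w : I + G t) : I + {t : T & G t} :=
  match w with inl i => inl i | inr k => inr (Tagged G k) end.
exists {t : T & G t}, (fun k => gmap (@r (tag k)) (g (tag k) (tagged k))).
exists (fun p => r (tag p) (o (tag p) (tagged p))), (fun k x => v (tag k) (tagged k) x).
split.
- rewrite card_tagged sumnE big_map enumT.
  by apply: leq_sum => t _; case: (H t).
- move=> x [t k] /=; rewrite geval_gmap; case: (H t) => _ h _ _; rewrite h.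
  by apply: eq_geval; case.
- move=> x v' hv [t k] /=; case: (H t) => _ _ h _.
  rewrite -(h x (fun k => v' (Tagged G k))) // => {}k.
  by rewrite hv geval_gmap /=; apply: eq_geval; case.
move=> [t j] x /=; case: (H t) => _ _ _ ->.
by case: (o t j).
Qed.

Lemma comp_fam X I (J : finType) (a : I -> X -> bool) (b : J -> X -> bool) s :
  (forall j, comp a (fun _ : unit => b j) s) -> comp a b (#|J| * s).
Proof.
move=> h; apply: comp_le (comp_sub (p := fun j => Tagged (fun=> unit) tt) _ (comp_sig h)).
  by rewrite sum_nat_const.
by [].
Qed.

Lemma comp_sum X I J1 J2 (a : I -> X -> bool) (b1 : J1 -> X -> bool)
    (b2 : J2 -> X -> bool) s1 s2 :
  comp a b1 s1 -> comp a b2 s2 ->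
  comp a (fun j => match j with inl j => b1 j | inr j => b2 j end) (s1 + s2).
Proof.
move=> h1 h2.
pose J (c : bool) : Type := if c then J1 else J2.
pose b (c : bool) : J c -> X -> bool := if c return J c -> X -> bool then b1 else b2.
have h c : comp a (b c) (if c then s1 else s2) by case: c.
apply: comp_le (comp_sub (p := fun j : J1 + J2 => match j with
  inl j => Tagged J (j : J true) | inr j => Tagged J (j : J false) end) _ (comp_sig h)).
  by rewrite big_bool.
by case.
Qed.

Lemma comp_pair X I J1 J2 K (a : I -> X -> bool) (b1 : J1 -> X -> bool)
    (b2 : J2 -> X -> bool) (b : K -> X -> bool) (p : K -> J1 + J2) s1 s2 :
  (forall k x, b k x = match p k with inl j => b1 j x | inr j => b2 j x end) ->
  comp a b1 s1 -> comp a b2 s2 -> comp a b (s1 + s2).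
Proof.
move=> h h1 h2; apply: (comp_sub (p := p) _ (comp_sum h1 h2)) => k x.
by rewrite h; case: (p k).
Qed.

Lemma eq_comp X I J (a : I -> X -> bool) (b b' : J -> X -> bool) s :
  (forall j x, b' j x = b j x) -> comp a b s -> comp a b' s.
Proof. exact: (@comp_sub _ _ _ _ _ _ _ id). Qed.

Lemma comp_not X I (a : I -> X -> bool) (b : X -> bool) s :
  comp a (fun _ : unit => b) s -> comp a (fun (_ : unit) x => ~~ b x) s.+1.
Proof.
move=> h; rewrite -addn1; apply: comp_trans h _.
by apply: (@comp_nand _ _ _ _ _ tt tt) => k x; rewrite andbb.
Qed.

Lemma comp_and X I (a : I -> X -> bool) (b c : X -> bool) s s' :
  comp a (fun _ : unit => b) s -> comp a (fun _ : unit => c) s' ->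
  comp a (fun (_ : unit) x => b x && c x) (s + s').+2.
Proof.
move=> h h'; apply: eq_comp (comp_not (s := (s + s').+1) (b := fun x => ~~ (b x && c x)) _).
  by move=> j x; rewrite negbK.
rewrite -addn1; apply: comp_trans (comp_sum h h') _.
by apply: (@comp_nand _ _ _ _ _ (inl tt) (inr tt)).
Qed.

Lemma comp_or X I (a : I -> X -> bool) (b c : X -> bool) s s' :
  comp a (fun _ : unit => b) s -> comp a (fun _ : unit => c) s' ->
  comp a (fun (_ : unit) x => b x || c x) (s + s').+3.
Proof.
move=> h h'; rewrite -addSn -addnS -addn1.
apply: comp_trans (comp_sum (comp_not h) (comp_not h')) _.
apply: (@comp_nand _ _ _ _ _ (inl tt) (inr tt)) => k x.
by rewrite negb_and !negbK.
Qed.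

Lemma comp_all X I (T : Type) (a : I -> X -> bool) (b : T -> X -> bool) s l :
  (forall t, comp a (fun _ : unit => b t) s) ->
  comp a (fun (_ : unit) x => all (b^~ x) l) (size l * s.+2).+2.
Proof.
move=> h; elim: l => [|t l IH]; first by apply: (@comp_cst _ _ _ _ _ (fun=> true)).
by apply: comp_le (comp_and (h t) IH) => /=; lia.
Qed.

Lemma comp_has X I (T : Type) (a : I -> X -> bool) (b : T -> X -> bool) s l :
  (forall t, comp a (fun _ : unit => b t) s) ->
  comp a (fun (_ : unit) x => has (b^~ x) l) (size l * s.+3).+2.
Proof.
move=> h; elim: l => [|t l IH]; first by apply: (@comp_cst _ _ _ _ _ (fun=> false)).
by apply: comp_le (comp_or (h t) IH) => /=; lia.
Qed.

Lemma comp_in X I (a : I -> X -> bool) i : comp a (fun _ : unit => a i) 0.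
Proof. by apply: (@comp_proj _ _ _ _ _ (fun=> i)). Qed.

(** * Finite-valued functions in one-hot representation *)

Definition onehot X J (T : eqType) (u : J -> X -> T) (p : J * T) (x : X) : bool :=
  u p.1 x == p.2.

(** A disjunctive normal form over all tables [f]. Its size depends only on the finite types, not on
    [X], [J] or [phi], so one cell of a machine step has constant cost. *)
Lemma comp_local (A T T' : finType) (h : {ffun A -> T} -> T') :
  exists K, forall X J (u : J -> X -> T) (phi : A -> J),
    comp (onehot u) (onehot (fun (_ : unit) x => h [ffun i => u (phi i) x])) K.
Proof.
pose k1 := (#|A| * 2).+2; pose k2 := (#|{ffun A -> T}| * k1.+3).+2.
exists (#|{: unit * T'}| * k2) => X J u phi.
apply: comp_fam => -[[] t'].
have e j x : onehot (fun (_ : unit) x => h [ffun i => u (phi i) x]) (j, t') x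
   = has (fun f : {ffun A -> T} => (h f == t') &&
           all (fun i => onehot u (phi i, f i) x) (enum A)) (enum {ffun A -> T}).
  rewrite /onehot /=; apply/eqP/hasP => [<-|[f _ /andP[/eqP<- /allP hf]]].
    exists [ffun i => u (phi i) x]; rewrite ?mem_enum // eqxx /=.
    by apply/allP => i _; rewrite ffunE.
  by congr h; apply/ffunP => i; rewrite ffunE; apply/eqP/hf; rewrite mem_enum.
apply: eq_comp (fun j x => e tt x) _.
rewrite /k2 cardT.
apply: (@comp_has _ _ _ _ (fun f x => (h f == t') &&
   all (fun i => onehot u (phi i, f i) x) (enum A))) => f.
case: (h f == t') => /=; last first.
  by apply: comp_le (@comp_cst _ _ _ _ _ (fun=> false) _); rewrite /k1.
rewrite /k1 cardT.
apply: (@comp_all _ _ _ _ (fun i x => onehot u (phi i, f i) x)) => i.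
exact: comp_in.
Qed.

(** * Circuits for bit strings *)

Definition cell (s : bits) (j : nat) : option bool := nth None [seq Some b | b <- s] j.

Lemma cell_cat s t j :
  cell (s ++ t) j = if j < size s then cell s j else cell t (j - size s).
Proof. by rewrite /cell map_cat nth_cat size_map. Qed.

Lemma cellE s j : cell s j = if j < size s then Some (nth false s j) else None.
Proof.
by rewrite /cell; case: ltnP => h; [rewrite (nth_map false) | rewrite nth_default ?size_map].
Qed.

(* Strings of length at most [N] whose length may depend on the input. *)
Definition comp_str X I (a : I -> X -> bool) (e : X -> bits) (N s : nat) :=
  (forall x, size (e x) <= N) /\
  comp a (onehot (fun (j : 'I_N) x => cell (e x) j)) s.

(* Strings of input-independent length, with [k] gates per bit. *)
Definition comp_bits X I (a : I -> X -> bool) (k : nat) (e : X -> bits) :=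
  (exists N, forall x, size (e x) = N) /\
  forall j, comp a (fun (_ : unit) x => nth false (e x) j) k.

Lemma comp_bits_cst X I (a : I -> X -> bool) k s : 2 <= k -> comp_bits a k (fun=> s).
Proof.
move=> hk; split; first by exists (size s).
by move=> j; apply: comp_le hk (@comp_cst _ _ _ _ _ (fun=> nth false s j) _).
Qed.

Lemma nth_bpair s t j :
  nth false (bpair s t) j =
    if j < (size s).*2 then if odd j then nth false s j./2 else true
    else if j == (size s).*2 then false else nth false t (j - (size s).*2.+1).
Proof.
rewrite /bpair; elim: s j => [|b s IH] [|[|j]] //=; rewrite ?subn1 //.
rewrite IH doubleS !ltnS !eqSS negbK subSS subSS.
by [].
Qed.

Lemma size_bpair s t : size (bpair s t) = (size s).*2 + (size t).+1.
Proof. by rewrite size_cat /=; congr (_ + _); elim: s => //= b s ->; rewrite doubleS. Qed.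

Lemma comp_bits_bpair X I (a : I -> X -> bool) k e1 e2 : 2 <= k ->
  comp_bits a k e1 -> comp_bits a k e2 -> comp_bits a k (fun x => bpair (e1 x) (e2 x)).
Proof.
move=> hk [[n1 h1] c1] [[n2 h2] c2]; split=> [|j].
  by exists (n1.*2 + n2.+1) => x; rewrite size_bpair h1 h2.
have cst b : comp a (fun (_ : unit) _ => b) k.
  by apply: comp_le hk (@comp_cst _ _ _ _ _ (fun=> b) _).
case: (ltnP j n1.*2) => h.
  case: (boolP (odd j)) => o.
    by apply: eq_comp (c1 j./2) => _ x; rewrite nth_bpair h1 h o.
  by apply: eq_comp (cst true) => _ x; rewrite nth_bpair h1 h (negPf o).
case: (eqVneq j n1.*2) => [->|o].
  by apply: eq_comp (cst false) => _ x; rewrite nth_bpair h1 ltnn eqxx.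
apply: eq_comp (c2 (j - n1.*2.+1)) => _ x.
by rewrite nth_bpair h1 ltnNge h (negPf o).
Qed.

Lemma comp_bits_enc_seq X I (T : Type) (a : I -> X -> bool) k (f : T -> X -> bits) l :
  2 <= k -> (forall t, comp_bits a k (f t)) ->
  comp_bits a k (fun x => enc_seq [seq f t x | t <- l]).
Proof.
move=> hk hf; elim: l => [|t l IH] /=; first exact: comp_bits_cst.
exact: comp_bits_bpair.
Qed.

Lemma comp_str_bits X I (a : I -> X -> bool) k e N :
  (forall x, size (e x) <= N) -> comp_bits a k e ->
  comp_str a e N (N * 3 * k.+2).
Proof.
move=> hN [[n hn] c]; split=> //.
have -> : N * 3 * k.+2 = #|{: 'I_N * option bool}| * k.+2.
  by rewrite card_prod card_ord card_option card_bool.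
apply: comp_fam => -[j t]; rewrite /onehot /=.
case: (ltnP j n) => h.
  case: t => [[]|].
  - by apply: comp_le (eq_comp _ (c j)) => [|_ x]; [lia | rewrite cellE hn h; case: nth].
  - apply: comp_le (eq_comp _ (comp_not (c j))) => [|_ x]; [lia |].
    by rewrite cellE hn h; case: nth.
  apply: (comp_le _ (@comp_cst _ _ _ _ _ (fun=> false) _)) => //.
  by move=> _ x; rewrite cellE hn h.
apply: (comp_le _ (@comp_cst _ _ _ _ _ (fun=> None == t) _)) => //.
by move=> _ x; rewrite cellE hn ltnNge h.
Qed.

Lemma comp_str_cell X I (a : I -> X -> bool) e N s j t :
  comp_str a e N s -> comp a (fun (_ : unit) x => cell (e x) j == t) s.+2.
Proof.
move=> [hN c]; case: (ltnP j N) => h.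
  apply: comp_le (comp_sub (p := fun=> (Ordinal h, t)) _ c) => //; lia.
apply: (comp_le _ (@comp_cst _ _ _ _ _ (fun=> None == t) _)) => //.
by move=> _ x; rewrite cellE ltnNge (leq_trans (hN x) h).
Qed.

Lemma comp_str_extend X I (a : I -> X -> bool) e N s N' :
  comp_str a e N s -> comp a (onehot (fun (j : 'I_N') x => cell (e x) j)) s.+2.
Proof.
move=> [hN c]; rewrite -[s.+2]addn2.
pose b (p : 'I_N' * option bool) (x : X) := None == p.2.
pose p (q : 'I_N' * option bool) : ('I_N * option bool) + ('I_N' * option bool) :=
  if insub (val q.1) is Some j then inl (j, q.2) else inr q.
apply: (comp_pair (b2 := b) (p := p) _ c); last exact: (@comp_cst _ _ _ _ _ (fun q => None == q.2)).
move=> [j t] x; rewrite /p /onehot /b /=; case: insubP => [i _ <- //|] /=.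
by rewrite -leqNgt => h; rewrite cellE ltnNge (leq_trans (hN x) h).
Qed.

(** Only the second string may vary in length: the fixed length of [e1] makes the offset of [e2] a
    constant. *)
Lemma comp_str_cat X I (a : I -> X -> bool) k e1 e2 N1 N2 s2 :
  comp_bits a k e1 -> comp_str a e2 N2 s2 ->
  (forall x, size (e1 x ++ e2 x) <= N1) ->
  comp_str a (fun x => e1 x ++ e2 x) N1 (N1 * 3 * k.+2 + s2.+2).
Proof.
move=> [[n hn] c1] c2 hN; split=> //.
have hn1 (x : X) : n <= N1 by rewrite -(hn x) (leq_trans _ (hN x)) // size_cat leq_addr.
have c1' : comp a (onehot (fun (j : 'I_N1) x => cell (take N1 (e1 x)) j)) (N1 * 3 * k.+2).
  suff [] : comp_str a (fun x => take N1 (e1 x)) N1 (N1 * 3 * k.+2) by [].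
  apply: comp_str_bits => [x|]; first by rewrite size_take_min geq_minl.
  split; first by exists (minn N1 n) => x; rewrite size_take_min hn.
  move=> j; apply: eq_comp (c1 j) => _ x; by rewrite take_oversize // hn; apply: (hn1 x).
have c2' := comp_str_extend N1 c2.
pose p (q : 'I_N1 * option bool) : ('I_N1 * option bool) + ('I_N1 * option bool) :=
  if q.1 < n then inl q else inr (Ordinal (leq_ltn_trans (leq_subr n q.1) (ltn_ord q.1)), q.2).
apply: (comp_pair (p := p) _ c1' c2') => -[j t] x.
rewrite /p /onehot /=; case: ltnP => h /=.
  by rewrite cell_cat hn h take_oversize // hn; apply: (hn1 x).
by rewrite cell_cat hn ltnNge h.
Qed.

Lemma comp_str_bpair X I (a : I -> X -> bool) k e1 e2 N1 N2 s2 : 2 <= k ->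
  comp_bits a k e1 -> comp_str a e2 N2 s2 ->
  (forall x, size (bpair (e1 x) (e2 x)) <= N1) ->
  comp_str a (fun x => bpair (e1 x) (e2 x)) N1 (N1 * 3 * k.+2 + s2.+2).
Proof.
move=> hk h1 h2 hN.
have e x : bpair (e1 x) (e2 x) = bpair (e1 x) [::] ++ e2 x by rewrite /bpair -catA.
have h : comp_bits a k (fun x => bpair (e1 x) [::]).
  by apply: comp_bits_bpair => //; apply: comp_bits_cst.
have hN' x : size (bpair (e1 x) [::] ++ e2 x) <= N1 by rewrite -e.
have [k1 k2] := comp_str_cat h h2 hN'; split=> //.
by apply: eq_comp k2 => j x; rewrite /onehot e.
Qed.

(** * Circuits simulating Turing machines *)

Lemma tm_computes_in_le (M : tm) x n n' y :
  n <= n' -> tm_computes_in M x n y -> tm_computes_in M x n' y.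
Proof.
rewrite /tm_computes_in => /subnKC <-; rewrite addnC iterD.
set c := iter n _ _ => -[hc hy].
have hs : tm_step c = c by move: hc; rewrite /tm_halted /tm_step; case: tm_next.
by elim: (_ - _) => // m; rewrite iterSr hs.
Qed.

Section Simulation.
Variable M : tm.
Local Notation Q := (tm_state M).
Local Notation S := (symb (tm_work M)).
Local Notation k := (tm_tapes M).

(* Cells are addressed relative to the head, so that a cell of the next
   configuration depends on boundedly many cells of the current one, at
   addresses that do not depend on the configuration. *)
Definition addr := (unit + 'I_k.+1 * bool * nat)%type.

Definition view (c : config M) (p : addr) : Q + S :=
  match p with
  | inl _ => inl c.1
  | inr (i, lft, m) => inr (nth None (if lft then (c.2 i).1 else (c.2 i).2) m)
  end.

(** What one cell of the next configuration depends on: the state, the scanned symbols and four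
    nearby cells. Values 0 to 2 stand for positions [m - 1], [m], [m + 1] on the same side; 3 is the
    nearest cell left of the head, which a left move brings under it. *)
Definition probe := (unit + 'I_k.+1 + 'I_4)%type.
(** A step treats only positions 0 and 1 specially, so capping the position at 2 leaves finitely
    many local functions. *)
Definition target := option ('I_k.+1 * bool * 'I_3).

Definition probe_addr (p : addr) (r : probe) : addr :=
  match r with
  | inl (inl _) => inl tt
  | inl (inr i) => inr (i, false, 0)
  | inr d =>
    match p with
    | inl _ => inl tt
    | inr (i, lft, m) =>
      if d == 3 :> nat then inr (i, true, 0) else inr (i, lft, (m + d).-1)
    end
  end.

Definition addr_target (p : addr) : target :=
  match p with
  | inl _ => None
  | inr (i, lft, m) => Some (i, lft, inord (minn m 2))
  end.

Definition to_state (z : Q + S) : Q := if z is inl q then q else tm_start M.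
Definition to_symb (z : Q + S) : S := if z is inr s then s else None.

Definition local_step (d : target) (f : {ffun probe -> Q + S}) : Q + S :=
  let q := to_state (f (inl (inl tt))) in
  let rd := [ffun i => to_symb (f (inl (inr i)))] in
  let near j := to_symb (f (inr (inord j))) in
  match d with
  | None => inl (if tm_delta q rd is Some (q', _) then q' else q)
  | Some (i, lft, m) =>
    inr (if tm_delta q rd is Some (_, acts) then
      let: (a, mv) := acts i in
      match mv with
      | MoveL => if lft then near 2 else
                 if m == 0 :> nat then near 3 else if m == 1 :> nat then a else near 0
      | Stay => if lft then near 1 else if m == 0 :> nat then a else near 1
      | MoveR => if lft then if m == 0 :> nat then a else near 0 else near 2
      end else near 1)
  end.

Lemma view_step c p :
  view (tm_step c) p = local_step (addr_target p) [ffun r => view c (probe_addr p r)].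
Proof.
rewrite /local_step /addr_target /tm_step /tm_next.
have -> : [ffun i => to_symb ([ffun r => view c (probe_addr p r)] (inl (inr i)))] =
          [ffun i => tape_read (c.2 i)].
  by apply/ffunP => i; rewrite !ffunE /= nth0.
rewrite !ffunE /=.
case: p => [[]|[[i lft] m]] /=; first by case: tm_delta => [[]|].
have hm : (inord (minn m 2) : 'I_3) = minn m 2 :> nat by rewrite inordK // ltnS geq_minr.
rewrite hm !inordK //=.
case: tm_delta => [[q acts]|] /=; last by rewrite addn1.
congr inr; case: (acts i) => a mv; case: (c.2 i) => l r /=.
case: mv; case: lft => /=; rewrite ?addn2 ?addn1 ?addn0 /=.
- by rewrite nth_behead.
- by case: m {hm} => [|[|m]] //=; rewrite ?nth0 ?nth_behead //; case: r.
- by [].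
- by case: m {hm} => [|m] //=; rewrite ?nth_behead; case: m.
- by case: m {hm} => [|m] //=; case: m.
- by rewrite nth_behead.
Qed.

Definition waddr B := (unit + 'I_k.+1 * bool * 'I_B)%type.

Definition of_waddr B (p : waddr B) : addr :=
  match p with inl _ => inl tt | inr (i, lft, m) => inr (i, lft, val m) end.

Definition wview X (c : X -> config M) B (p : waddr B) (x : X) := view (c x) (of_waddr p).

Lemma card_waddr B : #|{: waddr B}| = 1 + k.+1 * 2 * B.
Proof. by rewrite card_sum card_unit !card_prod card_bool !card_ord. Qed.

(** A cell at position [m] depends on cells up to [m + 1], so the window of known cells shrinks by
    one per step; starting [T] cells wider pays for [T] steps. *)
Lemma comp_tm_step : exists K, forall X (c : X -> config M) B,
  comp (onehot (wview c (B := B.+1))) (onehot (wview (fun x => tm_step (c x)) (B := B)))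
    (K * B.+1).
Proof.
have [K hK] := fin_all_exists (fun d => comp_local (local_step d)).
exists ((1 + k.+1 * 2) * #|{: Q + S}| * \sum_d K d) => X c B.
pose to_w (p : addr) : waddr B.+1 :=
  match p with inl _ => inl tt | inr (i, lft, m) => inr (i, lft, inord m) end.
apply: (@comp_le _ _ _ _ _ (#|{: waddr B * (Q + S)}| * \sum_d K d)).
  rewrite card_prod card_waddr [leqRHS]mulnAC leq_mul2r [_ * _ * B.+1]mulnAC.
  by rewrite leq_mul2r; apply/orP; right; apply/orP; right; nia.
apply: comp_fam => -[p z].
have h := hK (addr_target (of_waddr p)) X (waddr B.+1) (wview c (B := B.+1))
   (fun r => to_w (probe_addr (of_waddr p) r)).
apply: comp_le (comp_sub (p := fun=> (tt, z)) _ h).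
  by rewrite (bigD1 (addr_target (of_waddr p))) //= leq_addr.
move=> _ x; rewrite /onehot /= {1}/wview view_step; congr (local_step _ _ == _).
apply/ffunP => r; rewrite !ffunE /wview; congr view.
case: p {h} => [[]|[[i lft] m]]; case: r => [[[]|i']|d] //=.
- by rewrite inordK.
- by rewrite inordK.
have hd := ltn_ord d; have hmB := ltn_ord m.
by case: ifP => hd3 /=; rewrite inordK //; move/eqP: hd3; lia.
Qed.

Lemma comp_tm_iter : exists K, forall X (c : X -> config M) B T,
  comp (onehot (wview c (B := B + T)))
    (onehot (wview (fun x => iter T (@tm_step M) (c x)) (B := B))) (K * T * (B + T).+1).
Proof.
have [K hK] := comp_tm_step; exists K => X c B T.
elim: T c => [|T IH] c; first by rewrite muln0 addn0; apply: comp_proj => //; apply: id.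
rewrite addnS; apply: comp_le (comp_trans (hK _ _ _) _); last first.
  apply: eq_comp (IH (fun x => tm_step (c x))) => j x.
  by rewrite /onehot /wview -iterSr.
nia.
Qed.

Lemma comp_tm_init : exists K, forall X (e : X -> bits) B,
  comp (onehot (fun (j : 'I_B) x => cell (e x) j))
    (onehot (wview (fun x => tm_init M (e x)) (B := B))) (K * B.+1).
Proof.
exists ((1 + k.+1 * 2) * #|{: Q + S}| * 2) => X e B.
apply: (@comp_le _ _ _ _ _ (#|{: waddr B * (Q + S)}| * 2)).
  rewrite card_prod card_waddr [leqRHS]mulnAC leq_mul2r [_ * _ * B.+1]mulnAC.
  by rewrite leq_mul2r; apply/orP; right; apply/orP; right; nia.
apply: comp_fam => -[p z].
have cst (b : bool) : comp (onehot (fun (j : 'I_B) x => cell (e x) j))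
    (fun (_ : unit) (_ : X) => b) 2 by apply: (@comp_cst _ _ _ _ _ (fun=> b)).
rewrite /onehot /wview; case: p => [[]|[[i lft] m]] /=.
  exact: cst.
case: lft => /=; first by rewrite nth_nil; apply: cst.
case: (i == ord0); last by rewrite nth_nil; apply: cst.
case: z => [q|z] /=; first exact: cst.
have e1 x : nth None [seq Some (inl b) | b <- e x] m = omap inl (cell (e x) m) :> S.
  rewrite /cell; elim: (e x) (val m) => [|b s IH] [|j] //=.
case: z => [[b|w]|] /=.
- apply: comp_le (comp_sub (p := fun=> (m, Some b)) _ (comp_proj (p := id) _)) => // _ x.
  by rewrite /onehot e1 /=; case: cell => [[]|] //=; case: b.
- by apply: eq_comp (cst false) => _ x; rewrite e1; case: cell.
apply: comp_le (comp_sub (p := fun=> (m, None)) _ (comp_proj (p := id) _)) => // _ x.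
by rewrite /onehot e1 /=; case: cell.
Qed.

Definition is_bit (z : S) : bool := (z == Some (inl true)) || (z == Some (inl false)).

Lemma cell_read_bits (r : seq S) j b :
  (cell (read_bits r) j == Some b) =
  all (fun i => is_bit (nth None r i)) (iota 0 j) && (nth None r j == Some (inl b)).
Proof.
elim: r j => [|[[b'|w]|] r IH] [|j] //=; rewrite ?andbF //.
rewrite IH; congr (_ && _); rewrite -[1]/(1 + 0) iotaDl all_map.
by have -> // : is_bit (Some (inl b')) by case: b'.
Qed.

Lemma comp_tm_output X (c : X -> config M) N :
  comp (onehot (wview c (B := N)))
    (onehot (fun (j : 'I_N) x => cell (tm_output (c x)) j)) (60 * N.+1 ^ 2).
Proof.
apply: (@comp_le _ _ _ _ _ (#|{: 'I_N * option bool}| * (20 * N.+1))).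
  by rewrite card_prod card_ord card_option card_bool -mulnn; nia.
apply: comp_fam => -[j t].
pose a := onehot (wview c (B := N)).
have hc (i : 'I_N) z : comp a (fun (_ : unit) x => nth None ((c x).2 ord_max).2 i == z) 0.
  by apply: (@comp_proj _ _ _ _ _ (fun=> (inr (ord_max, false, i), inr z))).
have hs b : comp a (fun (_ : unit) x => cell (tm_output (c x)) j == Some b) (5 * N + 4).
  pose P (i : 'I_j) x :=
    is_bit (nth None ((c x).2 ord_max).2 (widen_ord (ltnW (ltn_ord j)) i)).
  have hP i : comp a (fun _ : unit => P i) 3 by apply: comp_or (hc _ _) (hc _ _).
  apply: comp_le (eq_comp _ (comp_and (comp_all (enum 'I_j) hP) (hc j (Some (inl b))))).
    by rewrite size_enum_ord; have := ltn_ord j; lia.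
  move=> _ x; rewrite /tm_output cell_read_bits -val_enum_ord all_map.
  by congr (_ && _); apply: eq_all.
case: t => [b|]; first by apply: comp_le (hs b); lia.
apply: comp_le (eq_comp _ (comp_not (comp_or (hs true) (hs false)))); first by lia.
by move=> _ x; rewrite /onehot; case: cell => [[]|].
Qed.

End Simulation.

Lemma comp_tm (M : tm) : exists K, forall X I (a : I -> X -> bool) e N s T N',
  comp_str a e N s ->
  (forall x, size (tm_output (iter T (@tm_step M) (tm_init M (e x)))) <= N') ->
  comp_str a (fun x => tm_output (iter T (@tm_step M) (tm_init M (e x)))) N'
    (s + K * (N' + T).+1 ^ 2).
Proof.
have [K1 h1] := comp_tm_init M; have [K2 h2] := comp_tm_iter M.
exists (2 + K1 + K2 + 60) => X I a e N s T N' he hN; split=> //.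
apply: comp_le (comp_trans (comp_trans (comp_trans (comp_str_extend (N' + T) he)
  (h1 X e _)) (h2 X _ _ _)) (comp_tm_output _ _)).
rewrite !mulnDl -!mulnn.
have p1 : K1 * (N' + T).+1 <= K1 * ((N' + T).+1 * (N' + T).+1) by rewrite leq_mul2l; nia.
have p2 : K2 * T * (N' + T).+1 <= K2 * ((N' + T).+1 * (N' + T).+1).
  by rewrite -mulnA leq_mul2l; nia.
have p3 : N'.+1 * N'.+1 <= (N' + T).+1 * (N' + T).+1 by apply: leq_mul; lia.
lia.
Qed.

(** Halted configurations stay put, so every input can be run for the time bound of the longest one.
    The overhead [f] depends on the two length bounds only. *)
Lemma comp_poly_time A (P : A -> Prop) ein eout :
  poly_time P ein eout ->
  exists f : nat -> nat -> nat,
  [/\ forall g1 g2, polybounded g1 -> polybounded g2 -> polybounded (fun n => f (g1 n) (g2 n)) &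
  forall X I (a : I -> X -> bool) (u : X -> A) N N' s,
    (forall x, P (u x)) -> comp_str a (fun x => ein (u x)) N s ->
    (forall x, size (eout (u x)) <= N') ->
    comp_str a (fun x => eout (u x)) N' (s + f N N')].
Proof.
move=> [M [c hM]]; have [K hK] := comp_tm M.
exists (fun N N' => K * (N' + poly_bound c N).+1 ^ 2); split.
  move=> g1 g2 h1 h2; apply: polyboundedM; first exact: polybounded_cst.
  apply: polyboundedX; apply: polybounded_le (polyboundedD (polyboundedD h2 (polybounded_pb c h1))
    (polybounded_cst 1)) => n; lia.
move=> X I a u N N2 s hP he hN.
have hx x : tm_output (iter (poly_bound c N) (@tm_step M) (tm_init M (ein (u x)))) = eout (u x).
  have hle : poly_bound c (size (ein (u x))) <= poly_bound c N.
    by apply: poly_bound_mono; case: he.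
  by have [] := tm_computes_in_le hle (hM _ (hP x)).
have hN2 x : size (tm_output (iter (poly_bound c N) (@tm_step M) (tm_init M (ein (u x))))) <= N2.
  by rewrite hx.
have [_ h] := hK _ _ _ _ _ _ _ _ he hN2; split=> //.
by apply: eq_comp h => j x; rewrite /onehot hx.
Qed.

(** * A machine evaluating CNF formulas *)

(* [cnf] is a list of clauses; a clause gives two bits per variable (positive
   and negative occurrence) and is closed by the pair of bits [true; true].
   [sfx] holds the values of the variables still to be read in the current
   clause; variables beyond the end of the assignment [full] count as false, so
   that the length of a certificate need not be checked. *)
Fixpoint cnf_run (full sfx : bits) (ok sat : bool) (half : option bool) (cnf : bits) : bool :=
  if cnf is c :: cnf' then
    if half is Some c1 then
      if c1 && c then cnf_run full full (ok && sat) false None cnf'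
      else cnf_run full (behead sfx) ok (sat || (if head false sfx then c1 else c)) None cnf'
    else cnf_run full sfx ok sat (Some c) cnf'
  else ok.

Definition cnf_eval (full cnf : bits) := cnf_run full full true false None cnf.

(** Total, because the machine must agree with the verifier on malformed strings as well; the
    defaults are what the parser leaves on its tapes when a marker is missing. *)
Fixpoint unpair (z : bits) : bits * bits :=
  match z with
  | true :: b :: z' => let: (x, a) := unpair z' in (b :: x, a)
  | false :: z' => ([::], z')
  | _ => ([::], [::])
  end.

Lemma bpair_cons b x y : bpair (b :: x) y = [:: true, b & bpair x y].
Proof. by []. Qed.

Lemma unpairK x y : unpair (bpair x y) = (x, y).
Proof. by elim: x => //= b x ->. Qed.

Local Notation sy := (symb void).

Definition cstate := ('I_8 + bool + bool * bool * option bool + unit)%type.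
Local Notation Parse i := (inl (inl (inl (@Ordinal 8 i isT))) : cstate).
Local Notation Rewind ok := (inl (inl (inr ok)) : cstate).
Local Notation Row ok sat half := (inl (inr (ok, sat, half)) : cstate).
Local Notation Halt := (inr tt : cstate).

(* Parsing states: 0 start; 1, 3, 5 expect a marker of the outer pairing, the
   next bit being (2) a marker of the inner pairing, (4) a bit of the first
   component, (6) a bit of the second component; 7 copies the certificate.
   Tape 1 receives the first component followed by the certificate, tape 2 the
   reversal of the second component. *)
Definition cdelta (q : cstate) (r0 r1 r2 : sy) :
    option (cstate * (sy * move) * (sy * move) * (sy * move)) :=
  let bit1 := r0 == Some (inl true) in
  match q with
  | inl (inl (inl i)) =>
    match val i with
    | 0 => Some (Parse 1, (r0, Stay), (None, MoveR), (None, Stay))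
    | 1 => Some (if bit1 then Parse 2 else Parse 7, (r0, MoveR), (r1, Stay), (r2, Stay))
    | 2 => Some (if bit1 then Parse 3 else Parse 5, (r0, MoveR), (r1, Stay), (r2, Stay))
    | 3 => Some (if bit1 then Parse 4 else Parse 7, (r0, MoveR), (r1, Stay), (r2, Stay))
    | 4 => Some (Parse 1, (r0, MoveR), (r0, MoveR), (r2, Stay))
    | 5 => Some (if bit1 then Parse 6 else Parse 7, (r0, MoveR), (r1, Stay), (r2, Stay))
    | 6 => Some (Parse 5, (r0, MoveR), (r1, Stay), (r0, MoveL))
    | _ => if r0 == None then Some (Rewind true, (r0, Stay), (r1, MoveL), (r2, MoveR))
           else Some (Parse 7, (r0, MoveR), (r0, MoveR), (r2, Stay))
    end
  | inl (inl (inr ok)) =>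
    if r1 == None then Some (Row ok false None, (r0, Stay), (r1, MoveR), (r2, Stay))
    else Some (Rewind ok, (r0, Stay), (r1, MoveL), (r2, Stay))
  | inl (inr (ok, sat, half)) =>
    if r2 is Some (inl c) then
      if half is Some c1 then
        if c1 && c then Some (Rewind (ok && sat), (r0, Stay), (r1, MoveL), (r2, MoveR))
        else if r1 is Some (inl v) then
          Some (Row ok (sat || (if v then c1 else c)) None, (r0, Stay), (r1, MoveR), (r2, MoveR))
        else Some (Row ok (sat || c) None, (r0, Stay), (r1, Stay), (r2, MoveR))
      else Some (Row ok sat (Some c), (r0, Stay), (r1, Stay), (r2, MoveR))
    else Some (Halt, (r0, Stay), (r1, Stay), (Some (inl ok), Stay))
  | inr _ => None
  end.

Definition tape1 : 'I_3 := @Ordinal 3 1 isT.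

Definition cnf_tm : tm := @TM cstate void 2 (Parse 0)
  (fun q rd => if cdelta q (rd ord0) (rd tape1) (rd ord_max) is Some (q', a0, a1, a2)
     then Some (q', fun i => match val i with 0 => a0 | 1 => a1 | _ => a2 end)
     else None).

(** With the tapes as components of a tuple instead of values of a function, runs reduce by
    computation and are compared without functional extensionality. *)
Definition cconf := (cstate * tape void * tape void * tape void)%type.

Definition cstep (c : cconf) : cconf :=
  let: (q, t0, t1, t2) := c in
  if cdelta q (tape_read t0) (tape_read t1) (tape_read t2) is Some (q', a0, a1, a2)
  then (q', tape_upd t0 a0, tape_upd t1 a1, tape_upd t2 a2) else c.

Definition conf_of (c : config cnf_tm) : cconf :=
  (c.1, c.2 ord0, c.2 tape1, c.2 ord_max).

Lemma conf_of_step c : conf_of (tm_step c) = cstep (conf_of c).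
Proof.
rewrite /tm_step /tm_next /=; case: c => q t; rewrite /conf_of /= !ffunE.
by case: cdelta => [[[[q' a0] a1] a2]|].
Qed.

Lemma conf_of_iter n c : conf_of (iter n (@tm_step cnf_tm) c) = iter n cstep (conf_of c).
Proof. by elim: n => //= n <-; rewrite conf_of_step. Qed.

Lemma conf_of_halt c t0 t1 l2 r2 b :
  conf_of c = (Halt, t0, t1, (l2, Some (inl b) :: r2)) -> read_bits r2 = [::] ->
  tm_halted c /\ tm_output c = [:: b].
Proof.
case: c => q t [/= -> _ _ h] h2; split; first by [].
by rewrite /tm_output /= h /= h2.
Qed.

Definition msym (s : bits) : seq sy := [seq Some (inl b) | b <- s].

Lemma run_rewind ok t0 t2 (l : bits) r : exists t0',
  iter (size l).+1 cstep (Rewind ok, t0, (behead (rev (msym l) ++ [:: None]),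
     head None (rev (msym l) ++ [:: None]) :: r), t2)
  = (Row ok false None, t0', ([:: None], msym l ++ r), tape_upd t2 (tape_read t2, Stay)).
Proof.
have hid (t : tape void) : tape_upd (tape_upd t (tape_read t, Stay))
    (tape_read (tape_upd t (tape_read t, Stay)), Stay) = tape_upd t (tape_read t, Stay).
  by [].
elim/last_ind: l r t0 t2 => [|l a IH] r t0 t2.
  by exists (tape_upd t0 (tape_read t0, Stay)); case: t0 t2.
rewrite size_rcons iterSr /msym map_rcons rev_rcons /= -/(msym l).
have [t0' h] := IH (Some (inl a) :: r) (tape_upd t0 (tape_read t0, Stay))
  (tape_upd t2 (tape_read t2, Stay)).
exists t0'; move: h; rewrite hid cat_rcons /= => <-.
by case: t2.
Qed.

(** Each bit of the formula costs one step and, if it closes a clause, a rewind of at most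
    [size full + 1] steps. *)
Lemma run_rows full cnf : forall pre sfx ok sat half t0 l2, full = pre ++ sfx ->
  exists n t0' t1 l2', n <= 1 + size cnf * (size full + 2) /\
  iter n cstep (Row ok sat half, t0, (rev (msym pre) ++ [:: None], msym sfx ++ [:: None]),
    (l2, msym cnf)) =
  (Halt, t0', t1, (l2', [:: Some (inl (cnf_run full sfx ok sat half cnf))])).
Proof.
elim: cnf => [|c cnf IH] pre sfx ok sat half t0 l2 hf.
  by exists 1; do 3!eexists; split.
case: half => [c1|]; last first.
  have [n [t0' [t1 [l2' [hn h]]]]] := IH pre sfx ok sat (Some c)
    (tape_upd t0 (tape_read t0, Stay)) (Some (inl c) :: l2) hf.
  exists n.+1, t0', t1, l2'; split; first by move: hn => /=; lia.
  by rewrite iterSr -h; case: (sfx).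
case hcc: (c1 && c); last first.
  case: sfx hf => [|v sfx] hf.
    have [n [t0' [t1 [l2' [hn h]]]]] := IH pre [::] ok (sat || c) None
      (tape_upd t0 (tape_read t0, Stay)) (Some (inl c) :: l2) hf.
    exists n.+1, t0', t1, l2'; split; first by move: hn => /=; lia.
    by rewrite iterSr /= hcc -h.
  have [n [t0' [t1 [l2' [hn h]]]]] := IH (rcons pre v) sfx ok (sat || (if v then c1 else c)) None
    (tape_upd t0 (tape_read t0, Stay)) (Some (inl c) :: l2) ltac:(by rewrite cat_rcons).
  exists n.+1, t0', t1, l2'; split; first by move: hn => /=; lia.
  by rewrite iterSr /= hcc -h /msym map_rcons rev_rcons.
have [t0' hr] := run_rewind (ok && sat) (tape_upd t0 (tape_read t0, Stay))
  (Some (inl c) :: l2, msym cnf) pre (msym sfx ++ [:: None]).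
have hs : iter 1 cstep (Row ok sat (Some c1), t0, (rev (msym pre) ++ [:: None],
     msym sfx ++ [:: None]), (l2, msym (c :: cnf))) = (Rewind (ok && sat),
     tape_upd t0 (tape_read t0, Stay), (behead (rev (msym pre) ++ [:: None]),
     head None (rev (msym pre) ++ [:: None]) :: (msym sfx ++ [:: None])),
     (Some (inl c) :: l2, msym cnf)).
  by rewrite /= hcc; case: (sfx).
have hp : size pre <= size full by rewrite hf size_cat leq_addr.
have mf : msym pre ++ msym sfx ++ [:: None] = msym full ++ [:: None].
  by rewrite catA /msym -map_cat -hf.
(* A step in place turns the end of an exhausted tape into an explicit blank cell, so an empty
   remainder no longer has the form [msym cnf] and is run separately. *)
case: cnf IH hr hs => [|d cnf] IH hr hs.
  exists (1 + ((size pre).+1 + 1)); do 3!eexists; split; first by rewrite /=; lia.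
  by rewrite iterD iterD hs hr /= hcc.
have [n [t0'' [t1 [l2' [hn h]]]]] :=
  IH [::] full (ok && sat) false None t0' (Some (inl c) :: l2) erefl.
exists (n + ((size pre).+1 + 1)), t0'', t1, l2'; split.
  by move: hn; rewrite /= !mulSn; lia.
by rewrite !iterD hs hr mf h [cnf_run _ _ _ _ _ (c :: _)]/= hcc.
Qed.

(** The two conditions say that [r1] is empty or a single explicit blank: the same tape, in
    whichever form the preceding step left it. *)
Lemma run_copy y l0 l1 r1 r2 : head None r1 = None -> behead r1 = [::] -> exists t0',
  iter (size y).+1 cstep (Parse 7, (l0, msym y), (l1, r1), ([::], None :: r2)) =
  (Rewind true, t0', (behead (rev (msym y) ++ l1), [:: head None (rev (msym y) ++ l1); None]),
   ([:: None], r2)).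
Proof.
elim: y l0 l1 r1 => [|b y IH] l0 l1 r1 h1 h2.
  by eexists; rewrite /= /tape_read /= h1 h2.
have [t0' h] := IH (Some (inl b) :: l0) (Some (inl b) :: l1) [::] erefl erefl.
exists t0'; rewrite iterSr /= /tape_read /= h2 -iterS h.
by rewrite rev_cons cat_rcons.
Qed.

Lemma run_second z y l0 l1 r1 r2 : head None r1 = None -> behead r1 = [::] ->
  exists l0' r1', [/\ head None r1' = None, behead r1' = [::] &
  iter (size z).*2.+1 cstep (Parse 5, (l0, msym (bpair z y)), (l1, r1), ([::], None :: r2)) =
  (Parse 7, (l0', msym y), (l1, r1'), ([::], None :: rev (msym z) ++ r2))].
Proof.
elim: z l0 r1 r2 => [|b z IH] l0 r1 r2 h1 h2.
  by eexists; exists [:: None]; split=> //=; rewrite /tape_read /= h1 h2.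
have [l0' [r1' [k1 k2 h]]] := IH [:: Some (inl b), Some (inl true) & l0]
   [:: None] (Some (inl b) :: r2) erefl erefl.
exists l0', r1'; split=> //; rewrite bpair_cons doubleS 2!iterSr /=.
by rewrite /tape_read /= h1 h2 -iterS h rev_cons cat_rcons.
Qed.

Lemma run_parse n z y l0 l1 r1 : size z <= n -> head None r1 = None -> behead r1 = [::] ->
  exists k l0' r1', [/\ head None r1' = None, behead r1' = [::], k <= (size z).*2.+1 &
  iter k cstep (Parse 1, (l0, msym (bpair z y)), (l1, r1), ([::], [:: None])) =
  (Parse 7, (l0', msym y), (rev (msym (unpair z).1) ++ l1, r1'),
    ([::], None :: rev (msym (unpair z).2)))].
Proof.
elim: n z l0 l1 r1 => [|n IH] [|[] z] l0 l1 r1 // hz h1 h2;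
  try by exists 1; eexists; exists [:: None]; split=> //=; rewrite /tape_read /= h1 h2.
- case: z hz => [|b z] hz.
    exists 3; eexists; exists [:: None]; split=> //=.
    by rewrite /tape_read /= h1 h2.
  have [k [l0' [r1' [k1 k2 hk h]]]] := IH z
    [:: Some (inl b), Some (inl true), Some (inl true), Some (inl true) & l0]
    (Some (inl b) :: l1) [::] ltac:(by move: hz => /=; lia) erefl erefl.
  exists k.+4, l0', r1'; split=> //.
  rewrite !bpair_cons 4!iterSr /= /tape_read /= h2 h.
  by case: (unpair z) => x a /=; rewrite rev_cons cat_rcons.
have [l0' [r1' [k1 k2 h]]] := run_second z y
   [:: Some (inl false), Some (inl true) & l0] l1 [::] (r1 := [:: None]) erefl erefl.
exists (size z).*2.+3, l0', r1'; split=> //.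
rewrite bpair_cons 2!iterSr /= /tape_read /= h1 h2 -iterS h.
by rewrite cats0.
Qed.

(** The parser writes the second component leftwards, which reverses it; the advice is reversed in
    advance to compensate. *)
Definition cnf_verifier (z y : bits) : bool :=
  cnf_eval ((unpair z).1 ++ y) (rev (unpair z).2).

Lemma size_unpair z : size (unpair z).1 + size (unpair z).2 <= size z.
Proof.
have [n] := ubnP (size z); elim: n z => // n IH [|[] [|b z]] //= hz.
have := IH z; case: (unpair z) => x a /=; lia.
Qed.

Lemma cnf_tm_correct z y :
  exists2 n, n <= 20 * (size (bpair z y)).+2 ^ 2 &
    tm_computes_in cnf_tm (bpair z y) n [:: cnf_verifier z y].
Proof.
set full := (unpair z).1 ++ y; set cnf := rev (unpair z).2.
have [k [l0 [r1 [h1 h2 hk e1]]]] := run_parse y [::] [:: None] (r1 := [::])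
   (leqnn (size z)) erefl erefl.
have [t0 e2] := run_copy y l0 (rev (msym (unpair z).1) ++ [:: None])
   (rev (msym (unpair z).2)) h1 h2.
have [t0' e3] := run_rewind true t0 ([:: None], msym cnf) full [:: None].
have mcat : rev (msym y) ++ rev (msym (unpair z).1) ++ [:: None] = rev (msym full) ++ [:: None].
  by rewrite /full /msym map_cat rev_cat catA.
have mrev : rev (msym (unpair z).2) = msym cnf by rewrite /msym /cnf map_rev.
have e0 : conf_of (tm_init cnf_tm (bpair z y)) =
    (Parse 0, ([::], msym (bpair z y)), ([::], [::]), ([::], [::])) by [].
have e0' : cstep (Parse 0, ([::], msym (bpair z y)), ([::], [::]), ([::], [::])) =
   (Parse 1, ([::], msym (bpair z y)), ([:: None], [::]), ([::], [:: None])).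
  by rewrite /=; case: z {full cnf k l0 r1 h1 h2 hk e1 t0 e2 t0' e3 mcat mrev e0}.
have hsz := size_unpair z; have hb := size_bpair z y.
have hf : size full = size (unpair z).1 + size y by rewrite size_cat.
have hc : size cnf = size (unpair z).2 by rewrite size_rev.
have run n : iter (n + ((size full).+1 + ((size y).+1 + (k + 1)))) cstep
    (conf_of (tm_init cnf_tm (bpair z y))) =
  iter n cstep (Row true false None, t0', ([:: None], msym full ++ [:: None]),
    tape_upd ([:: None], msym cnf) (tape_read ([:: None], msym cnf), Stay)).
  by rewrite !iterD e0 [iter 1 _ _]e0' e1 e2 mrev mcat e3.
suff [n [t [t1 [l2 [hn h]]]]] : exists n t t1 l2, n <= 1 + size cnf * (size full + 2) /\
    iter n cstep (Row true false None, t0', ([:: None], msym full ++ [:: None]),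
    tape_upd ([:: None], msym cnf) (tape_read ([:: None], msym cnf), Stay)) =
    (Halt, t, t1, (l2, [:: Some (inl (cnf_verifier z y))])).
  exists (n + ((size full).+1 + ((size y).+1 + (k + 1)))).
    move: hn; rewrite hb hf hc -mulnn; nia.
  by apply: (@conf_of_halt _ t t1 l2 [::]); rewrite ?conf_of_iter ?run ?h.
rewrite /cnf_verifier -/full -/cnf /cnf_eval.
case: (cnf) => [|d s]; first by exists 1; do 3!eexists; split.
have [n [t [t1 [l2 [hn h]]]]] :=
  run_rows (d :: s) (pre := [::]) (sfx := full) true false None t0' [:: None] erefl.
by exists n, t, t1, l2; split=> //; rewrite -h.
Qed.

Lemma cnf_verifier_poly_time :
  poly_time (fun _ : bits * bits => True)
    (fun xy => bpair xy.1 xy.2) (fun xy => [:: cnf_verifier xy.1 xy.2]).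
Proof.
have [c hc] : polybounded (fun n => 20 * n.+2 ^ 2).
  apply: polyboundedM; first exact: polybounded_cst.
  apply: polyboundedX; apply: polybounded_le (polyboundedD polybounded_id (polybounded_cst 2)).
  by move=> n; rewrite addn2.
exists cnf_tm, c => -[z y] _; have [n hn h] := cnf_tm_correct z y.
exact: tm_computes_in_le (leq_trans hn (hc _)) h.
Qed.

(** * Polynomial-size circuits as advice *)

(* All literals of a clause have the same sign. *)
Definition clause := (bool * seq nat)%type.

Definition clause_lits (c : clause) (r : seq nat) : bits :=
  flatten [seq [:: c.1 && (i \in c.2); ~~ c.1 && (i \in c.2)] | i <- r].

Definition clause_row N (c : clause) : bits := clause_lits c (iota 0 N) ++ [:: true; true].

Lemma cnf_run_row full c rest ok N m sfx sat :
  cnf_run full sfx ok sat None (clause_lits c (iota m N) ++ [:: true, true & rest]) =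
  cnf_run full full
    (ok && (sat || has (fun i => (i \in c.2) && (nth false sfx (i - m) == c.1)) (iota m N)))
    false None rest.
Proof.
elim: N m sfx sat => [|N IH] m sfx sat; first by rewrite /= orbF.
have h : (c.1 && (m \in c.2)) && (~~ c.1 && (m \in c.2)) = false by case: c.1; case: (m \in c.2).
rewrite /= h IH subnn nth0 -orbA; congr (cnf_run _ _ (_ && (_ || _))); last first.
congr (_ || _).
  by case: head; case: c.1; case: (m \in c.2).
apply: eq_in_has => i; rewrite mem_iota => /andP[hi _]; rewrite nth_behead.
by rewrite -subSn.
Qed.

Definition clause_holds full (c : clause) := has (fun i => nth false full i == c.1) c.2.

Lemma cnf_eval_rows full N cs :
  all (fun c : clause => all (fun i => i < N) c.2) cs ->
  cnf_eval full (flatten [seq clause_row N c | c <- cs]) = all (clause_holds full) cs.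
Proof.
rewrite /cnf_eval; rewrite -[RHS]andTb; elim: cs true => [|c cs IH] ok /=; first by rewrite andbT.
move=> /andP[/allP hc hcs]; rewrite -catA /= cnf_run_row /= IH // -andbA; congr (_ && (_ && _)).
apply/hasP/hasP => -[i]; first by move=> _ /andP[ic]; rewrite subn0; exists i.
by move=> ic h; exists i; rewrite ?mem_iota ?hc ?ic ?subn0.
Qed.

Lemma size_rows N cs : size (flatten [seq clause_row N c | c <- cs]) = size cs * (N.*2 + 2).
Proof.
have h c r : size (clause_lits c r) = (size r).*2.
  by elim: r => //= i r; rewrite /clause_lits /= => ->; rewrite doubleS.
by elim: cs => //= c cs IH; rewrite size_cat IH mulSn size_cat h size_iota.
Qed.

Section CircuitCNF.
Variables (n : nat) (G : finType) (g : G -> gate ('I_n + G)) (out : 'I_n + G).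

Definition wire_index (w : 'I_n + G) : nat :=
  match w with inl i => i | inr k => n + enum_rank k end.
Arguments wire_index : simpl never.

(** Each clause of a NAND gate is purely positive or purely negative, which is why clauses of a
    single sign suffice. *)
Definition gate_clauses (k : G) : seq clause :=
  let v := wire_index (inr k) in
  match g k with
  | inl b => [:: (b, [:: v])]
  | inr (w1, w2) => [:: (true, [:: v; wire_index w1]); (true, [:: v; wire_index w2]);
                        (false, [:: v; wire_index w1; wire_index w2])]
  end.

Definition refuting_cnf : seq clause :=
  (false, [:: wire_index out]) :: flatten [seq gate_clauses k | k <- enum G].

Lemma wire_index_lt w : wire_index w < n + #|G|.
Proof.
rewrite /wire_index; case: w => [i|k]; last by rewrite ltn_add2l.
by apply: leq_trans (leq_addr _ _).
Qed.

Lemma refuting_cnf_lt :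
  all (fun c : clause => all (fun i => i < n + #|G|) c.2) refuting_cnf.
Proof.
have h := wire_index_lt; rewrite /= h /=; elim: (enum G) => //= k s IH.
rewrite all_cat IH andbT /gate_clauses.
by have := h (inr k); case: (g k) => [b|[w1 w2]] /= ->; rewrite ?h.
Qed.

Lemma size_refuting_cnf : size refuting_cnf <= 1 + 3 * #|G|.
Proof.
rewrite /= ltnS cardE; elim: (enum G) => //= k s IH.
rewrite size_cat mulnS leq_add // /gate_clauses; by case: (g k) => [b|[]].
Qed.

Definition assign_gates (y : bits) (k : G) : bool := nth false y (enum_rank k).

Lemma nth_wire (x : n.-tuple bool) y w :
  nth false (x ++ y) (wire_index w) = wval (tnth x) (assign_gates y) w.
Proof.
rewrite nth_cat size_tuple /wire_index; case: w => [i|k] /=.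
  by rewrite ltn_ord (tnth_nth false).
by rewrite ltnNge leq_addr /= addKn.
Qed.

Lemma refuting_cnfP (x : n.-tuple bool) y :
  reflect (consistent g (tnth x) (assign_gates y) /\
           wval (tnth x) (assign_gates y) out = false)
    (all (clause_holds (x ++ y)) refuting_cnf).
Proof.
rewrite /= {1}/clause_holds /= orbF nth_wire.
have -> : all (clause_holds (x ++ y)) (flatten [seq gate_clauses k | k <- enum G]) =
   [forall k, assign_gates y k == geval (g k) (wval (tnth x) (assign_gates y))].
  have -> ss : all (clause_holds (x ++ y)) (flatten ss) = all (all (clause_holds (x ++ y))) ss.
    by elim: ss => //= c ss IH; rewrite all_cat IH.
  rewrite all_map; apply/allP/forallP => h k.
    have := h k; rewrite mem_enum => /(_ isT); rewrite /= /gate_clauses.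
    case: (g k) => [b|[w1 w2]]; rewrite /clause_holds /= !nth_wire /=.
      by rewrite orbF andbT.
    by do 3!case: (wval _ _ _) || case: (assign_gates y k).
  move=> _ /=; move/eqP: (h k); rewrite /gate_clauses.
  case: (g k) => [b|[w1 w2]]; rewrite /clause_holds /= !nth_wire /= => ->.
    by rewrite eqxx.
  by do 2!case: (wval _ _ _).
apply: (iffP andP) => [[/eqP h1 /forallP h2]|[h1 h2]]; split=> //.
- by move=> k; apply/eqP.
- by rewrite h2.
by apply/forallP => k; rewrite -h1.
Qed.

End CircuitCNF.

(** A certificate against [x] is an assignment to the gates that satisfies the gate equations with
    output 0. These equations have exactly one solution, so a certificate exists iff the circuit
    rejects. *)
Lemma circuits_in_coNP_poly (L : language) s :
  polybounded s ->
  (forall n, exists2 b : n.-tuple bool -> bool,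
    comp (fun i x => tnth x i) (fun _ : unit => b) (s n) & forall x : n.-tuple bool, L x <-> b x) ->
  in_slash_poly in_coNP L.
Proof.
move=> hs hL.
have hadv n : exists adv : bits, size adv <= (1 + 3 * s n) * ((n + s n).*2 + 2) /\
   forall x, size x = n ->
     L x <-> ~ exists y, size y <= poly_bound 1 (size (bpair x adv)) /\ cnf_verifier (bpair x adv) y.
  have [b [G [g [o [v [h1 h2 h3 h4]]]]] hb] := hL n.
  exists (rev (flatten [seq clause_row (n + #|G|) c | c <- refuting_cnf g (o tt)])); split.
    rewrite size_rev size_rows leq_mul //; last by lia.
    by apply: leq_trans (size_refuting_cnf g (o tt)) _; lia.
  move=> x /eqP hx; set adv := rev _; pose t := Tuple hx.
  have ver y : reflect (consistent g (tnth t) (assign_gates y) /\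
      wval (tnth t) (assign_gates y) (o tt) = false) (cnf_verifier (bpair x adv) y).
    rewrite /cnf_verifier unpairK /= revK (cnf_eval_rows _ (refuting_cnf_lt g (o tt))).
    exact: (refuting_cnfP g (o tt) t).
  rewrite -[x]/(val t) hb; split=> [bt [y [_ /ver[c1 c2]]]|hy].
    have e := h3 t _ c1; move: bt; rewrite (h4 tt) /=.
    by case: (o tt) c2 => [i|k] /= => [->|] //; rewrite -e => ->.
  apply: contraT => nb; case: hy; exists [seq v k t | k <- enum G]; split.
    rewrite size_map -cardE size_bpair /adv size_rev size_rows /poly_bound expn1 /=; nia.
  have e : assign_gates [seq v k t | k <- enum G] =1 v^~ t.
    move=> k; rewrite /assign_gates (nth_map k) ?nth_enum_rank //.
    by rewrite -cardE.
  apply/ver; split.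
    move=> k; rewrite e h2; apply: eq_geval => -[i|k'] //=; by rewrite e.
  move: nb; rewrite (h4 tt) /=; case: (o tt) => [i|k] /=; first by move/negPf.
  by rewrite e => /negPf.
pose adv n := proj1_sig (constructive_indefinite_description _ (hadv n)).
have advP n := proj2_sig (constructive_indefinite_description _ (hadv n)).
have [c hc] : polybounded (fun n => (1 + 3 * s n) * ((n + s n).*2 + 2)).
  apply: polyboundedM.
    by apply: polyboundedD (polybounded_cst _) (polyboundedM (polybounded_cst _) hs).
  apply: polyboundedD (polybounded_cst _).
  apply: polybounded_le (polyboundedM (polybounded_cst 2) (polyboundedD polybounded_id hs)).
  by move=> n; rewrite mul2n.
exists (fun z => ~ exists y, size y <= poly_bound 1 (size z) /\ cnf_verifier z y), adv, c; split.
- exists cnf_verifier, 1; split; first exact: cnf_verifier_poly_time.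
  by move=> z; split=> [/NNPP|h H].
- by move=> n; apply: leq_trans (hc n); case: (advP n).
by move=> x; case: (advP (size x)) => _; apply.
Qed.

Lemma nth_allpairs S T R z (f : S -> T -> R) s t x0 y0 i j : i < size s -> j < size t ->
  nth z [seq f x y | x <- s, y <- t] (i * size t + j) = f (nth x0 s i) (nth y0 t j).
Proof.
elim: s i => //= x s IH [|i] hi hj; rewrite nth_cat size_map.
  by rewrite hj (nth_map y0).
rewrite mulSn -addnA ltnNge leq_addr /= addKn IH //.
Qed.

Lemma size_enc_digraph I (D : digraph I) : size (enc_digraph D) = nv I ^ 2.
Proof. by rewrite size_allpairs size_enum_ord -mulnn. Qed.

(** * Instances over an arbitrary finite vertex type *)

Section FinBNSL.
Variables (W : finType) (ent : W -> seq ({set W} * nat)).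
Hypothesis ent_uniq : forall w, uniq (unzip1 (ent w)).
Hypothesis ent_wf : forall w Z k, (Z, k) \in ent w -> w \notin Z /\ k != 0.
Variable thr : nat.

Definition rank_set (Z : {set W}) : {set 'I_#|W|} := enum_rank @: Z.

Lemma rank_set_inj : injective rank_set.
Proof. exact: imset_inj enum_rank_inj. Qed.

Definition fin_entries (v : 'I_#|W|) : seq ({set 'I_#|W|} * nat) :=
  [seq (rank_set e.1, e.2) | e <- ent (enum_val v)].

Lemma fin_entries_uniq v : uniq (unzip1 (fin_entries v)).
Proof.
rewrite /unzip1 /fin_entries -map_comp (map_comp rank_set fst).
by rewrite (map_inj_uniq rank_set_inj); apply: ent_uniq.
Qed.

Lemma fin_entries_wf v Z k : (Z, k) \in fin_entries v -> v \notin Z /\ k != 0.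
Proof.
case/mapP => -[Z' k'] he [-> ->]; have [h1 h2] := ent_wf he; split=> //.
by apply: contra h1 => /imsetP[w wZ ->]; rewrite enum_rankK.
Qed.

Definition fin_bnsl : bnsl := BNSL (Posz thr) fin_entries_uniq fin_entries_wf.

Definition arc (D : digraph fin_bnsl) (w w' : W) : bool := (enum_rank w, enum_rank w') \in D.

Definition par (D : digraph fin_bnsl) (w : W) : {set W} := [set w' | arc D w' w].

Definition wscore (w : W) (Z : {set W}) : nat := \sum_(e <- ent w | e.1 == Z) e.2.

Lemma parents_rank (D : digraph fin_bnsl) w : parents D (enum_rank w) = rank_set (par D w).
Proof.
apply/setP => v; rewrite inE; apply/idP/imsetP => [h|[w' + ->]]; last by rewrite inE.
by exists (enum_val v); rewrite ?inE /arc enum_valK.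
Qed.

Lemma fin_score (D : digraph fin_bnsl) : score D = \sum_w wscore w (par D w).
Proof.
rewrite /score (reindex (@enum_rank W)) /=; last exact/onW_bij/enum_rank_bij.
apply: eq_bigr => w _; rewrite parents_rank /fscore /= /fin_entries enum_rankK big_map /=.
by apply: eq_bigl => e; rewrite (inj_eq rank_set_inj).
Qed.

Lemma wscore_neq0 w Z : wscore w Z != 0 -> exists2 k, (Z, k) \in ent w & wscore w Z = k.
Proof.
rewrite /wscore; elim: (ent w) (ent_uniq w) => [|[Z' k] s IH] /=; first by rewrite big_nil.
rewrite big_cons /= => /andP[hZ hs]; case: (eqVneq Z' Z) => [eZ _|_ h]; last first.
  by have [k' h1 h2] := IH hs h; exists k'; rewrite // inE h1 orbT.
exists k; first by rewrite eZ mem_head.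
rewrite big1_seq ?addn0 // => -[Z'' k''] /andP[/eqP /= e1 e2]; case/negP: hZ.
by rewrite eZ -e1; apply/mapP; exists (Z'', k'').
Qed.

Lemma wscore_ent w Z k : (Z, k) \in ent w -> wscore w Z = k.
Proof.
move=> h; have hk : wscore w Z != 0.
  rewrite /wscore (big_rem _ h) /= eqxx; case: (ent_wf h) => _; lia.
have [k' h1 ->] := wscore_neq0 hk.
have : uniq (unzip1 (ent w)) by apply: ent_uniq.
elim: (ent w) h h1 => //= e s IH; rewrite !inE => /orP[/eqP<-|h] /orP[/eqP|h'] /=.
- by case.
- by case/andP => /negP[]; apply/mapP; exists (Z, k').
- by move=> <- /andP[/negP[]]; apply/mapP; exists (Z, k).
by move=> /andP[_]; apply: IH.
Qed.

Lemma acyclic_arcF (D : digraph fin_bnsl) w w' :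
  acyclic D -> arc D w w' -> arc D w' w -> w != w' -> False.
Proof.
move=> hD h1 h2 hw; apply: (hD [:: enum_rank w; enum_rank w']) => //.
apply/andP; split; first by rewrite /= -!/(arc _ _ _) h1 h2.
by rewrite /= inE (inj_eq enum_rank_inj) hw.
Qed.

Definition digraph_of (r : rel W) : digraph fin_bnsl :=
  [set p | r (enum_val p.1) (enum_val p.2)].

Lemma arc_digraph_of r w w' : arc (digraph_of r) w w' = r w w'.
Proof. by rewrite /arc inE /= !enum_rankK. Qed.

Lemma acyclic_digraph_of (r : rel W) (lv : W -> nat) :
  (forall w w', r w w' -> lv w < lv w') -> acyclic (digraph_of r).
Proof.
move=> hr [//|v p] _ /andP[/= hp _].
pose e (u v : 'I_#|W|) := lv (enum_val u) < lv (enum_val v).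
have : path e v (rcons p v).
  by apply: sub_path hp => u u'; rewrite inE /=; apply: hr.
have etr : transitive e by move=> a b c; apply: ltn_trans.
move=> /(order_path_min etr) /allP /(_ v).
by rewrite mem_rcons mem_head /e ltnn => /(_ isT).
Qed.

(** Components stay inside the classes of [blk], and the local feedback edge number of a component
    is at most its number of edges. *)
Lemma fin_lfen (B : eqType) (blk : W -> B) m :
  (forall w Z k w', (Z, k) \in ent w -> w' \in Z -> blk w' = blk w) ->
  (forall w, #|[set w' | blk w' == blk w]| <= m) ->
  lfen_superstructure fin_bnsl <= m ^ 2.
Proof.
move=> hblk hm; pose bk (v : 'I_#|W|) := blk (enum_val v).
have hP a b : a \in @Pto fin_bnsl b -> bk a = bk b.
  case/bigcupP => Z; rewrite inE /fscore => hZ aZ.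
  have [e /mapP[[Z' k] he ->] /eqP e1] : exists2 e, e \in @entries fin_bnsl b & e.1 == Z.
    apply/hasP; apply: contraT => /hasPn hn; move: hZ.
    by rewrite big1_seq ?eqxx // => e /andP[h /hn]; rewrite h.
  rewrite /= in e1; move: aZ; rewrite -e1 => /imsetP[w wZ ->].
  by rewrite /bk enum_rankK; apply: hblk he wZ.
have hE x y : adj (superstructure fin_bnsl) x y -> bk x = bk y.
  case/imsetP => -[a b]; rewrite inE /= => hab exy.
  have eab : bk a = bk b by case/orP: hab => /hP.
  have : x \in [set a; b] by rewrite -exy set21.
  have : y \in [set a; b] by rewrite -exy set22.
  by rewrite !inE => /orP[]/eqP-> /orP[]/eqP->.
apply/bigmax_leqP => x _; set C := component _ _.
have hC y : y \in C -> bk y = bk x.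
  rewrite inE {C} => /connectP[p hp ->] {y}; elim: p x hp => //= y p IH x /andP[hxy hp].
  by rewrite (IH y) // (hE x y).
have cC : #|C| <= m.
  rewrite -(card_imset _ (@enum_val_inj W W)); apply: leq_trans (hm (enum_val x)).
  apply: subset_leq_card; apply/subsetP => w /imsetP[y yC ->].
  by rewrite inE; apply/eqP/hC.
apply: (@leq_trans #|[set e in superstructure fin_bnsl | e \subset C]|).
  (* The default value of the minimum gives this bound without exhibiting a spanning tree. *)
  rewrite /lfen_connected; elim/big_rec: _ => // F k _ h.
  by rewrite geq_min h orbT.
apply: (@leq_trans #|[set [set p.1; p.2] | p in setX C C]|).
  apply: subset_leq_card; apply/subsetP => e; rewrite inE => /andP[/imsetP[[a b] _ ->] /= hs].
  apply/imsetP; exists (a, b) => //; rewrite inE /=.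
  by rewrite !(subsetP hs) // ?set21 ?set22.
by apply: leq_trans (leq_imset_card _ _) _; rewrite cardsX -mulnn leq_mul.
Qed.

Lemma fin_nth_digraph (D : digraph fin_bnsl) w w' :
  nth false (enc_digraph D) (enum_rank w * #|W| + enum_rank w') = arc D w w'.
Proof.
have h := @nth_allpairs _ _ _ false (fun u v => (u, v) \in D) (enum 'I_#|W|) (enum 'I_#|W|)
  (enum_rank w) (enum_rank w') (enum_rank w) (enum_rank w').
rewrite size_enum_ord in h; rewrite /enc_digraph h // /arc.
by rewrite !nth_ord_enum.
Qed.

End FinBNSL.

(** * Constraint satisfaction as structure learning *)

Lemma sum_tight (I : finType) (f : I -> nat) k :
  (forall i, f i <= k) -> #|I| * k <= \sum_i f i -> forall i, f i = k.
Proof.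
move=> hf hs i; apply/eqP; rewrite eqn_leq hf leqNgt; apply/negP => hi.
suff : \sum_j f j < #|I| * k by lia.
rewrite -sum_nat_const (bigD1 i) //= [ltnRHS](bigD1 i) //=.
by rewrite -addSn leq_add // leq_sum.
Qed.

Section Gadget.
Variables (Var C : finType) (Gm : C -> {set {set Var * bool}}) (wt : Var * bool -> nat).
Hypothesis wt_bound : forall l, 0 < wt l <= 3.

(* A literal vertex scores when the literal is false: its parents are then the
   opposite literal and all constraints mentioning it.  A constraint vertex
   scores when its parents form an allowed pattern of literals.  By acyclicity
   at most one literal of each variable scores, and a scoring literal is not a
   parent of a constraint. *)
Definition gvertex := ((Var * bool) + C)%type.

Definition lits (c : C) : {set Var * bool} := cover (Gm c).

Definition lit_parents (l : Var * bool) : {set gvertex} :=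
  [set w | match w with inl l' => l' == (l.1, ~~ l.2) | inr c => l \in lits c end].

Definition gent (w : gvertex) : seq ({set gvertex} * nat) :=
  match w with
  | inl l => [:: (lit_parents l, wt l)]
  | inr c => [seq (inl @: (P : {set Var * bool}), 3) | P <- enum (Gm c)]
  end.

Lemma gent_uniq w : uniq (unzip1 (gent w)).
Proof.
case: w => [l|c] //=; rewrite /unzip1 -map_comp.
by rewrite map_inj_uniq ?enum_uniq // => P Q /= /(imset_inj inl_inj).
Qed.

Lemma gent_wf w Z k : (Z, k) \in gent w -> w \notin Z /\ k != 0.
Proof.
case: w => [[v b]|c] /=.
  rewrite inE => /eqP[-> ->]; split; last by have := wt_bound (v, b); lia.
  by rewrite inE /= xpair_eqE eqxx /=; case: b.
case/mapP => P _ [-> ->]; split=> //; by apply/imsetP => -[].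
Qed.

(** In an acyclic digraph each variable and each constraint contributes at most 3, so this threshold
    forces each to contribute exactly 3. *)
Definition gadget : bnsl := fin_bnsl gent_uniq gent_wf (3 * (#|Var| + #|C|)).

Definition gterm (D : digraph gadget) (i : Var + C) : nat :=
  match i with
  | inl v => wscore gent (inl (v, true)) (par D (inl (v, true)))
           + wscore gent (inl (v, false)) (par D (inl (v, false)))
  | inr c => wscore gent (inr c) (par D (inr c))
  end.

Lemma gadget_score (D : digraph gadget) : score D = \sum_i gterm D i.
Proof.
rewrite fin_score !big_sumType /=; congr (_ + _).
transitivity (\sum_v \sum_b wscore gent (inl (v, b)) (par D (inl (v, b)))).
  by rewrite pair_bigA; apply: eq_bigr => -[].
by apply: eq_bigr => v _; rewrite big_bool.
Qed.

(** In a solution this arc is present exactly when the negative literal of [v] is the scoring one,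
    that is, when [v] is true. *)
Definition assignment_of (D : digraph gadget) (v : Var) : bool :=
  arc D (inl (v, true)) (inl (v, false)).

Lemma gadget_sound (D : digraph gadget) : solution D ->
  (forall v, wt (v, ~~ assignment_of D v) = 3) /\
  (forall c, exists2 P, P \in Gm c & forall l, l \in P -> assignment_of D l.1 = l.2).
Proof.
move=> [hac]; rewrite /= gadget_score => hsc.
set F := gterm D in hsc.
have lit_sc l : wscore gent (inl l) (par D (inl l)) != 0 ->
    par D (inl l) = lit_parents l /\ wscore gent (inl l) (par D (inl l)) = wt l.
  by case/(wscore_neq0 gent_uniq) => k /=; rewrite inE => /eqP[-> ->].
have lit_arc l : wscore gent (inl l) (par D (inl l)) != 0 ->
    arc D (inl (l.1, ~~ l.2)) (inl l).
  move=> /lit_sc[h _]; have : inl (l.1, ~~ l.2) \in par D (inl l) by rewrite h inE eqxx.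
  by rewrite inE.
have excl v : wscore gent (inl (v, true)) (par D (inl (v, true))) != 0 ->
   wscore gent (inl (v, false)) (par D (inl (v, false))) != 0 -> False.
  by move=> /lit_arc h1 /lit_arc h2; apply: (acyclic_arcF hac h1 h2); apply/eqP => -[].
have hF i : F i <= 3.
  case: i => [v|c] /=.
    case: (eqVneq (wscore gent (inl (v, true)) (par D (inl (v, true)))) 0) => [->|h1].
      rewrite add0n; case: (eqVneq (wscore gent (inl (v, false)) (par D (inl (v, false)))) 0).
        by move=> ->.
      by move=> /lit_sc[_ ->]; case/andP: (wt_bound (v, false)).
    case: (eqVneq (wscore gent (inl (v, false)) (par D (inl (v, false)))) 0) => [->|/(excl _ h1)//].
    by rewrite addn0; case/lit_sc: h1 => _ ->; case/andP: (wt_bound (v, true)).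
  case: (eqVneq (wscore gent (inr c) (par D (inr c))) 0) => [->//|].
  by case/(wscore_neq0 gent_uniq) => k /mapP[P _ [_ ->]] ->.
have hT i : F i = 3.
  by apply: sum_tight => //; rewrite card_sum mulnC -lez_nat.
have scoring v : wscore gent (inl (v, ~~ assignment_of D v)) (par D (inl (v, ~~ assignment_of D v))) = 3.
  have := hT (inl v); rewrite /= /assignment_of.
  case: (eqVneq (wscore gent (inl (v, true)) (par D (inl (v, true)))) 0) => [->|h1].
    rewrite add0n => h; have -> : arc D (inl (v, true)) (inl (v, false)); last by [].
    by apply: (lit_arc (v, false)); rewrite h.
  have h2 : wscore gent (inl (v, false)) (par D (inl (v, false))) = 0.
    by apply/eqP; apply/negP => /negP /(excl _ h1).
  rewrite h2 addn0 => h; suff -> : arc D (inl (v, true)) (inl (v, false)) = false by [].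
  by apply/negP => h3; apply: (acyclic_arcF hac h3 (lit_arc _ h1)); apply/eqP => -[].
split=> [v|c].
  by have h := scoring v; rewrite -h; case: (lit_sc (v, ~~ assignment_of D v)); rewrite ?h.
have := hT (inr c) => /= hc.
have : wscore gent (inr c) (par D (inr c)) != 0 by rewrite hc.
case/(wscore_neq0 gent_uniq) => k /mapP[P]; rewrite mem_enum => PG [hp _] _.
(* A literal of [P] violated by the assignment would be a scoring one, with [c] among its parents,
   while [c] has it as a parent: a directed 2-cycle. *)
exists P => // -[v b] lP /=; apply/eqP; rewrite eq_sym -[_ == _]negbK; apply/negP => hne.
have eb : b = ~~ assignment_of D v by case: b (assignment_of D v) hne {lP} => [] [].
have h1 : wscore gent (inl (v, b)) (par D (inl (v, b))) != 0 by rewrite eb scoring.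
have [h2 _] := lit_sc _ h1.
have a1 : arc D (inr c) (inl (v, b)).
  have : inr c \in par D (inl (v, b)).
    by rewrite h2 inE; apply/bigcupP; exists P.
  by rewrite inE.
have a2 : arc D (inl (v, b)) (inr c).
  have : inl (v, b) \in par D (inr c) by rewrite hp imset_f.
  by rewrite inE.
exact: (acyclic_arcF hac a1 a2).
Qed.

Definition grel (al : Var -> bool) (w w' : gvertex) : bool :=
  match w, w' with
  | inl l, inl l' => (l' == (l.1, ~~ l.2)) && (al l.1 == l.2)
  | inl l, inr c => (l \in lits c) && (al l.1 == l.2)
  | inr c, inl l => (l \in lits c) && (al l.1 != l.2)
  | inr _, inr _ => false
  end.

Definition gsolution (al : Var -> bool) : digraph gadget := digraph_of _ _ _ (grel al).

Lemma gadget_complete (al : Var -> bool) :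
  (forall v, wt (v, ~~ al v) = 3) ->
  (forall c, [set l in lits c | al l.1 == l.2] \in Gm c) ->
  solution (gsolution al).
Proof.
move=> hwt hG; split.
  (* True literals, then constraints, then false literals: every arc goes up in this order. *)
  apply: (acyclic_digraph_of (lv := fun w => match w with
     | inl l => if al l.1 == l.2 then 0 else 2 | inr _ => 1 end)).
  move=> [[v b]|c] [[v' b']|c'] //=.
  - by case/andP => /eqP[-> ->] /eqP->; rewrite eqxx; case: b.
  - by case/andP => _ ->.
  by case/andP => _ /negPf->.
rewrite /= lez_nat gadget_score mulnC -card_sum -sum_nat_const; apply: leq_sum => -[v|c] _.
  have h : par (gsolution al) (inl (v, ~~ al v)) = lit_parents (v, ~~ al v).
    apply/setP => -[[v' b]|c]; rewrite !inE arc_digraph_of /=.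
      rewrite !xpair_eqE /=; case: (eqVneq v v') => [<-|] //=.
      by case: b; case: (al v).
    by rewrite andbC; case: (al v).
  have h3 : wscore gent (inl (v, ~~ al v)) (lit_parents (v, ~~ al v)) = 3.
    by apply: (wscore_ent gent_uniq gent_wf); rewrite /= hwt inE.
  by move: h h3; case: (al v) => /= -> ->; rewrite ?leq_addl ?leq_addr.
rewrite /gterm; have -> : par (gsolution al) (inr c) = inl @: [set l in lits c | al l.1 == l.2].
  apply/setP => -[l|c']; rewrite !inE arc_digraph_of /=.
    by rewrite mem_imset ?inE //; apply: inl_inj.
  by apply/esym/negbTE/imsetP => -[].
by rewrite (@wscore_ent _ _ gent_uniq gent_wf _ _ 3) //=; apply: map_f; rewrite mem_enum.
Qed.

End Gadget.

(** * Lossy maps and covers *)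

Definition upd (K : finType) (Y : Type) (u : {ffun K -> Y}) (k : K) (y : Y) : {ffun K -> Y} :=
  [ffun k' => if k' == k then y else u k'].

(** Resampling one coordinate preserves the uniform distribution: exchanging [y] with [u k] is an
    involution on the pairs [(u, y)]. *)
Lemma sum_upd (K Y : finType) (h : {ffun K -> Y} -> nat) (k : K) :
  \sum_u \sum_y h (upd u k y) = #|Y| * \sum_u h u.
Proof.
transitivity (\sum_(p : {ffun K -> Y} * Y) h p.1); last first.
  rewrite -(pair_bigA _ (fun u (y : Y) => h u)) /= big_distrr /=.
  by apply: eq_bigr => u _; rewrite sum_nat_const.
rewrite pair_bigA /=.
pose phi (p : {ffun K -> Y} * Y) := (upd p.1 k p.2, p.1 k).
have phiK : involutive phi.
  move=> [u y]; rewrite /phi /= ffunE eqxx; congr pair.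
  by apply/ffunP => k'; rewrite !ffunE; case: eqP => [->|].
by rewrite [RHS](reindex_inj (inv_inj phiK)).
Qed.

(* [G u] has too few values to reproduce most patterns [s]; where it fails at
   position [i], the coordinate [(i, ~~ s i)] of [u] has been hit.  Averaging
   over [u] yields a choice of the remaining coordinates hitting many [y]. *)
Lemma exists_hitting_test (Y : finType) t m
    (G : {ffun 'I_t * bool -> Y} -> {ffun 'I_t -> bool} -> {ffun 'I_t -> bool}) :
  m < t -> (forall u, #|[set G u s | s : {ffun 'I_t -> bool}]| <= 2 ^ m) -> 0 < #|Y| ->
  exists u (s : {ffun 'I_t -> bool}) i,
    #|Y| <= 2 * t * #|[set y | G (upd u (i, ~~ s i) y) s i != s i]|.
Proof.
move=> hmt hG hY.
pose A u (s : {ffun 'I_t -> bool}) i : nat := G u s i != s i.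
pose U := #|{ffun 'I_t * bool -> Y}|.
(* At most [2 ^ m] patterns are reproduced, so at least half of all [2 ^ t] fail at some
   position. *)
have h1 u : 2 ^ t <= 2 * \sum_s \sum_i A u s i.
  have cS : #|{ffun 'I_t -> bool}| = 2 ^ t by rewrite card_ffun card_bool card_ord.
  have hfix : #|[set s | G u s == s]| <= 2 ^ m.
    apply: leq_trans (hG u); apply: subset_leq_card; apply/subsetP => s.
    by rewrite inE => /eqP e; apply/imsetP; exists s.
  have h2m : 2 ^ m * 2 <= 2 ^ t by rewrite -expnSr leq_exp2l.
  have hne : #|~: [set s | G u s == s]| <= \sum_s \sum_i A u s i.
    rewrite -sum1_card big_mkcond /=; apply: leq_sum => s _; case: ifP => //.
    rewrite !inE => /eqP hs; rewrite lt0n; apply/eqP => /eqP; rewrite sum_nat_eq0 => /forallP h0.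
    apply: hs; apply/ffunP => i; apply/eqP; have := h0 i; rewrite /A.
    by case: (G u s i == s i).
  have := cardsC [set s | G u s == s]; rewrite cS; lia.
case: (boolP [exists u, exists s : {ffun 'I_t -> bool}, exists i,
    #|Y| <= 2 * t * #|[set y | G (upd u (i, ~~ s i) y) s i != s i]|]).
  by case/existsP => u /existsP[s /existsP[i h]]; exists u, s, i.
(* Otherwise every choice of [u], [s], [i] hits fewer than [#|Y| / (2 * t)] values of the resampled
   coordinate, and summing over all choices contradicts [h1]. *)
move=> hn; exfalso.
have hlt u (s : {ffun 'I_t -> bool}) i : 2 * t * (\sum_y A (upd u (i, ~~ s i) y) s i) <= #|Y|.-1.
  rewrite -ltnS prednK // ltnNge; apply: contra hn => h.
  apply/existsP; exists u; apply/existsP; exists s; apply/existsP; exists i.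
  apply: leq_trans h _; rewrite leq_mul2l; apply/orP; right.
  rewrite -sum1_card [leqRHS]big_mkcond /=; apply: leq_sum => y _.
  by rewrite inE /A; case: (_ != _).
pose T := \sum_u \sum_s \sum_i A u s i.
have hT1 : U * 2 ^ t <= 2 * T.
  by rewrite /T big_distrr /= -sum_nat_const; apply: leq_sum => u _; apply: h1.
have hT2 : 2 * t * (#|Y| * T) <= 2 ^ t * (t * (U * #|Y|.-1)).
  have -> : T = \sum_(s : {ffun 'I_t -> bool}) \sum_i \sum_u A u s i.
    by rewrite /T exchange_big; apply: eq_bigr => s _; rewrite exchange_big.
  have cS : #|{ffun 'I_t -> bool}| = 2 ^ t by rewrite card_ffun card_bool card_ord.
  rewrite -cS big_distrr big_distrr /= -sum_nat_const; apply: leq_sum => s _.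
  have -> : t * (U * #|Y|.-1) = \sum_(i < t) U * #|Y|.-1 by rewrite sum_nat_const card_ord.
  rewrite big_distrr big_distrr /=.
  apply: leq_sum => i _; rewrite -(sum_upd (fun u => A u s i) (i, ~~ s i)).
  by rewrite big_distrr /= -sum_nat_const; apply: leq_sum => u _; apply: hlt.
have hU : 0 < U by rewrite /U card_ffun expn_gt0 hY.
have h2 : 0 < 2 ^ t by rewrite expn_gt0.
have h3 : t * #|Y| * (U * 2 ^ t) <= t * #|Y| * (2 * T) by rewrite leq_mul2l hT1 orbT.
have h4 : t * (U * 2 ^ t) * #|Y| <= t * (U * 2 ^ t) * #|Y|.-1 by lia.
move: h4; rewrite leq_mul2l -ltnS prednK // ltnn orbF.
by rewrite !muln_eq0; lia.
Qed.

Section Cover.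
Variables (X : finType) (S : {set X}) (Valid : (X -> bool) -> Prop) (K : nat).
Hypothesis hit : forall Y : {set X}, Y \subset S -> Y != set0 ->
  exists2 T, Valid T & #|Y| <= K * #|[set y in Y | T y]|.

Definition missed (ts : seq {T | Valid T}) (Y : {set X}) : {set X} :=
  [set y in Y | ~~ has (fun T : {T | Valid T} => sval T y) ts].

(** While more than half of [Y] is missed, some test hits a [1/K] share of the missed part, hence
    more than [#|Y| / (2 * K)] new elements. The second alternative records this progress; at
    [j = K > 0] it implies the first. *)
Lemma cover_half (Y : {set X}) j : Y \subset S ->
  exists2 ts, size ts <= j & (2 * #|missed ts Y| <= #|Y|) \/
    (j * #|Y| <= 2 * K * (#|Y| - #|missed ts Y|)).
Proof.
move=> YS; elim: j => [|j [ts hts [h|h]]]; first by exists [::] => //; right.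
  by exists ts; [apply: leqW | left].
case: (leqP (2 * #|missed ts Y|) #|Y|) => hm.
  by exists ts; [apply: leqW | left].
have sm : missed ts Y \subset Y by apply/subsetP => y; rewrite inE => /andP[].
have nm : missed ts Y != set0 by rewrite -card_gt0; lia.
have [T vT hT] := hit (subset_trans sm YS) nm.
exists (exist _ T vT :: ts) => //; right.
have e : #|missed (exist _ T vT :: ts) Y| + #|[set y in missed ts Y | T y]| = #|missed ts Y|.
  rewrite -(cardsID [set y | T y] (missed ts Y)) addnC; congr (_ + _).
    by apply: eq_card => y; rewrite !inE.
  by apply: eq_card => y; rewrite !inE /= negb_or andbCA andbC.
have := subset_leq_card sm; rewrite mulSn; nia.
Qed.

(** Each round of [K] tests at least halves the uncovered part, so [n] rounds exhaust fewer than
    [2 ^ n] elements. *)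
Lemma cover_by_tests n (Y : {set X}) : Y \subset S -> #|Y| < 2 ^ n ->
  exists2 ts, size ts <= K * n &
    forall y, y \in Y -> has (fun T : {T | Valid T} => sval T y) ts.
Proof.
elim: n Y => [|n IH] Y YS hY.
  exists [::] => // y yY; have : 0 < #|Y| by apply/card_gt0P; exists y.
  by move: hY; rewrite expn0; lia.
have [ts hts hm] := cover_half K YS.
have {}hm : 2 * #|missed ts Y| <= #|Y|.
  case: hm => //; have : #|missed ts Y| <= #|Y|.
    by apply: subset_leq_card; apply/subsetP => y; rewrite inE => /andP[].
  case: (posnP K) => [K0|hK]; last by nia.
  case: (eqVneq Y set0) => [->|nY]; first by rewrite cards0; lia.
  have [T _] := hit YS nY; rewrite K0 mul0n leqn0 cards_eq0.
  by rewrite (negPf nY).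
have sm : missed ts Y \subset S.
  by apply: subset_trans YS; apply/subsetP => y; rewrite inE => /andP[].
have [|ts' hts' h'] := IH _ sm; first by move: hY; rewrite expnS; lia.
exists (ts ++ ts'); first by rewrite size_cat mulnS leq_add.
move=> y yY; rewrite has_cat; apply/orP; case: (boolP (has _ ts)) => hy; [by left|right].
by apply: h'; rewrite inE yY.
Qed.

End Cover.

(** * Disjoint copies of a circuit *)

(** The wires [k], [w1], [w2] may coincide; a pattern can then contain opposite literals, but no
    assignment agrees with such a pattern. *)
Definition gate_patterns (V : finType) (k : V) (g : gate V) : {set {set V * bool}} :=
  match g with
  | inl b => [set [set (k, b)]]
  | inr (w1, w2) =>
    [set [set (k, ~~ (b.1 && b.2)); (w1, b.1); (w2, b.2)] | b : bool * bool]
  end.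

Lemma gate_patterns_sound (V : finType) (k : V) g (al : V -> bool) P :
  P \in gate_patterns k g -> (forall l, l \in P -> al l.1 = l.2) -> al k = geval g al.
Proof.
case: g => [b|[w1 w2]] /=; first by rewrite inE => /eqP-> /(_ (k, b)) ->; rewrite ?inE.
case/imsetP => -[b1 b2] _ -> /= h.
rewrite (h (k, ~~ (b1 && b2))) ?inE ?eqxx //= (h (w1, b1)) ?inE ?eqxx ?orbT //=.
by rewrite (h (w2, b2)) ?inE ?eqxx ?orbT.
Qed.

Lemma gate_patterns_complete (V : finType) (k : V) g (al : V -> bool) :
  al k = geval g al ->
  [set l in cover (gate_patterns k g) | al l.1 == l.2] \in gate_patterns k g.
Proof.
case: g => [b|[w1 w2]] /= hk.
  rewrite inE; apply/eqP/setP => l; rewrite /cover big_set1 !inE.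
  by case: eqP => //= ->; rewrite /= hk eqxx.
apply/imsetP; exists (al w1, al w2) => //=; apply/setP => -[v b]; rewrite !inE /=.
apply/andP/idP => [[/bigcupP[P /imsetP[[b1 b2] _ ->]] /=]|].
  by rewrite !inE -hk !xpair_eqE => /orP[/orP[]|] /andP[/eqP-> _] /eqP <-;
    rewrite !eqxx ?orbT.
move=> h; split.
  apply/bigcupP; exists [set (k, ~~ (al w1 && al w2)); (w1, al w1); (w2, al w2)].
    by apply/imsetP; exists (al w1, al w2).
  by rewrite !inE.
by move: h; rewrite -hk !xpair_eqE => /orP[/orP[]|] /andP[/eqP-> /eqP->].
Qed.

Lemma card_gate_patterns (V : finType) (k : V) g : #|gate_patterns k g| <= 4.
Proof.
case: g => [b|[w1 w2]] /=; first by rewrite cards1.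
by apply: leq_trans (leq_imset_card _ _) _; rewrite card_prod card_bool.
Qed.

(* The inputs of a circuit: two instances of length [n], a bit selecting one
   of them, and a witness for the selected one. *)
Definition inp n p := (bool * 'I_n + option 'I_p)%type.

Definition selected n p (x : inp n p -> bool) : n.-tuple bool :=
  [tuple x (inl (x (inr None), i)) | i < n].

Definition claimed n p (x : inp n p -> bool) : p.-tuple bool :=
  [tuple x (inr (Some i)) | i < p].

Section Blocks.
Variables (n p t : nat) (rel : n.-tuple bool -> p.-tuple bool -> bool).
Variables (G : finType) (g : G -> gate (inp n p + G)) (out : inp n p + G).
Variable v : G -> (inp n p -> bool) -> bool.
Hypothesis v_cons : forall x, consistent g x (v^~ x).
Hypothesis v_uniq : forall x v', consistent g x v' -> v' =1 v^~ x.
Hypothesis outP : forall x, wval x (v^~ x) out = rel (selected x) (claimed x).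

Definition bvar := ('I_t * (inp n p + G))%type.
Definition bcon := ('I_t * option G)%type.

Definition bpatterns (c : bcon) : {set {set bvar * bool}} :=
  match c.2 with
  | Some k => gate_patterns (c.1, inr k) (gmap (pair c.1) (g k))
  | None => [set [set ((c.1, out), true)]]
  end.

Implicit Type u : {ffun 'I_t * bool -> n.-tuple bool}.

(** On an input wire only the literal contradicting the given bit has weight 3. The scoring literal,
    which is the false one, must have weight 3 in a solution, so the wire carries the given bit. *)
Definition bweight u (l : bvar * bool) : nat :=
  match l.1.2 with
  | inl (inl (side, i)) => 2 + (tnth (u (l.1.1, side)) i (+) l.2)
  | _ => 3
  end.

Lemma bweight_bound u l : 0 < bweight u l <= 3.
Proof.
case: l => -[j w] b; rewrite /bweight /=.
by case: w => [[[side i]|z]|k] //=; case: (_ (+) _).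
Qed.

Definition binst u : bnsl := gadget bpatterns (bweight_bound u).

Definition selection u (D : digraph (binst u)) (j : 'I_t) : bool :=
  assignment_of D (j, inl (inr None)).

Lemma binst_sound u (D : digraph (binst u)) : solution D ->
  forall j, exists w, rel (u (j, selection D j)) w.
Proof.
move=> /gadget_sound; set al := assignment_of D => -[hwt hc] j.
pose x (i : inp n p) := al (j, inl i).
have hx : consistent g x (fun k => al (j, inr k)).
  move=> k; have [P hP h] := hc (j, Some k).
  rewrite (gate_patterns_sound hP h) geval_gmap; apply: eq_geval.
  by case.
have hin side i : x (inl (side, i)) = tnth (u (j, side)) i.
  have := hwt (j, inl (inl (side, i))); rewrite /bweight /= -/(x _).
  by case: (x _); case: (tnth _ _).
exists (claimed x); have := outP x.
have [P] := hc (j, None); rewrite inE => /eqP -> /(_ ((j, out), true)).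
rewrite inE eqxx /= => /(_ isT) ho.
have -> : wval x (v^~ x) out = true.
  by rewrite -ho /x; case: (out) => //= k; rewrite -(v_uniq hx).
move=> hr; suff <- : selected x = u (j, selection D j) by rewrite -hr.
by apply: eq_from_tnth => i; rewrite tnth_mktuple hin.
Qed.

Variables (s : {ffun 'I_t -> bool}) (w : 'I_t -> p.-tuple bool).

Definition binput u (j : 'I_t) (z : inp n p) : bool :=
  match z with
  | inl (side, i) => tnth (u (j, side)) i
  | inr None => s j
  | inr (Some i) => tnth (w j) i
  end.

Definition bassign u (q : bvar) : bool :=
  wval (binput u q.1) (v^~ (binput u q.1)) q.2.

Definition bsol u : digraph (binst u) := gsolution bpatterns (bweight_bound u) (bassign u).

Lemma bsol_solution u : (forall j, rel (u (j, s j)) (w j)) -> solution (bsol u).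
Proof.
move=> hrel; apply: gadget_complete.
  case=> j [[[side i]|z]|k]; rewrite /bweight //=.
  by rewrite /bassign /=; case: (tnth _ _).
case=> j [k|].
  apply: gate_patterns_complete; rewrite geval_gmap /bassign /= v_cons.
  by apply: eq_geval; case.
rewrite /lits /bpatterns /= inE; apply/eqP/setP => l; rewrite /cover big_set1 !inE.
case: eqP => //= -> /=; rewrite /bassign /= outP.
have -> : selected (binput u j) = u (j, s j).
  by apply: eq_from_tnth => i; rewrite tnth_mktuple.
have -> : claimed (binput u j) = w j.
  by apply: eq_from_tnth => i; rewrite tnth_mktuple.
by rewrite hrel.
Qed.

(** Two literals per wire, one constraint per gate and one for the output. *)
Definition block_size := 2 * (#|{: inp n p}| + #|G|) + #|G|.+1.

Lemma card_bvertex : #|{: gvertex bvar bcon}| = t * block_size.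
Proof.
have h1 : #|{: bvar}| = t * (#|{: inp n p}| + #|G|) by rewrite card_prod card_ord card_sum.
have h2 : #|{: bcon}| = t * #|G|.+1 by rewrite card_prod card_ord card_option.
by rewrite card_sum card_prod h1 h2 card_bool /block_size; lia.
Qed.

(** No pattern mixes blocks, so the bound is that of a single block; [t] can be chosen after the
    vertex bound of the compression. *)
Lemma binst_lfen u : lfen_superstructure (binst u) <= block_size ^ 2.
Proof.
pose blk (z : gvertex bvar bcon) : 'I_t := match z with inl l => l.1.1 | inr c => c.1 end.
have hP c P l : P \in bpatterns c -> l \in P -> l.1.1 = c.1.
  case: c => j [k|]; rewrite /bpatterns /=; last first.
    by rewrite inE => /eqP->; rewrite inE => /eqP->.
  case: (g k) => [b|[w1 w2]] /=; first by rewrite inE => /eqP->; rewrite inE => /eqP->.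
  by case/imsetP => b _ ->; rewrite !inE => /orP[/orP[]|] /eqP->.
apply: (@fin_lfen _ _ _ _ _ _ blk).
  move=> [l|c] Z k z /=.
    rewrite inE => /eqP[-> _]; rewrite inE; case: z => [l' /eqP->|c] //=.
    by case/bigcupP => P h1 h2; rewrite (hP _ _ _ h1 h2).
  case/mapP => P; rewrite mem_enum => hP' [-> _] /imsetP[l lP ->] /=.
  exact: hP hP' lP.
move=> z; pose f (y : ((inp n p + G) * bool) + option G) : gvertex bvar bcon :=
  match y with inl l => inl ((blk z, l.1), l.2) | inr c => inr (blk z, c) end.
have -> : block_size = #|{: ((inp n p + G) * bool) + option G}|.
  have h1 : #|{: inp n p + G}| = #|{: inp n p}| + #|G| by rewrite card_sum.
  by rewrite card_sum card_prod h1 card_bool card_option /block_size; lia.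
rewrite -cardsT; apply: leq_trans (leq_imset_card f setT).
apply: subset_leq_card; apply/subsetP => y; rewrite inE => /eqP hy; apply/imsetP.
case: y hy => [[[j a] b]|[j c]] /= hy.
  by exists (inl (a, b)) => //=; rewrite -hy.
by exists (inr c) => //=; rewrite -hy.
Qed.

End Blocks.

(** * Encodings of the instances *)

Lemma comp_bits_map X I T (a : I -> X -> bool) k (b : T -> X -> bool) l : 2 <= k ->
  (forall q, comp a (fun _ : unit => b q) k) -> comp_bits a k (fun x => [seq b q x | q <- l]).
Proof.
move=> hk hb; split; first by exists (size l) => x; rewrite size_map.
move=> j; case: (ltnP j (size l)) => h.
  case: l h => // q0 l h.
  by apply: eq_comp (hb (nth q0 (q0 :: l) j)) => _ x; rewrite (nth_map q0).
apply: comp_le hk (@comp_cst _ _ _ _ _ (fun=> false) _) => _ x.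
by rewrite nth_default // size_map.
Qed.

Lemma eq_comp_bits X I (a : I -> X -> bool) k e e' :
  e =1 e' -> comp_bits a k e -> comp_bits a k e'.
Proof.
move=> h [[N hN] hc]; split; first by exists N => x; rewrite -h.
by move=> j; apply: eq_comp (hc j) => _ x; rewrite h.
Qed.

Definition enc_rank_set (W : finType) (Z : {set W}) : bits :=
  enc_seq [seq enc_unary (val i) | i <- enum (rank_set Z)].

Definition enc_ents (W : finType) (l : seq ({set W} * nat)) : bits :=
  enc_seq [seq bpair (enc_rank_set e.1) (enc_binary e.2) | e <- l].

Lemma enc_fin_bnsl (W : finType) ent hu hw thr :
  enc_bnsl (@fin_bnsl W ent hu hw thr) =
  enc_seq [:: enc_unary #|W|; enc_int_unary (Posz thr);
              enc_seq [seq enc_ents (ent (enum_val v)) | v <- enum 'I_#|W|]].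
Proof.
rewrite /enc_bnsl /=; congr (bpair _ (bpair _ (bpair (enc_seq _) _))).
by apply: eq_map => v; rewrite /fin_entries -map_comp.
Qed.

Lemma size_enc_seq_le l m : all (fun s : bits => size s <= m) l ->
  size (enc_seq l) <= size l * (2 * m).+1.
Proof.
elim: l => //= s l IH /andP[hs /IH hl]; rewrite size_bpair mulSn -mul2n; lia.
Qed.

Lemma size_enc_rank_set (W : finType) (Z : {set W}) :
  size (enc_rank_set Z) <= #|W| * (2 * #|W|).+1.
Proof.
apply: leq_trans (size_enc_seq_le (m := #|W|) _) _.
  by apply/allP => s /mapP[i _ ->]; rewrite size_nseq; apply: ltnW; apply: ltn_ord.
rewrite size_map -cardE leq_mul2r; apply/orP; right.
by apply: leq_trans (max_card _) _; rewrite card_ord.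
Qed.

(** Weights 2 and 3 both have two binary digits, so all strings [u] give encodings of the same
    layout, differing in one bit per input weight. *)
Lemma enc_binary_weight (b : bool) : enc_binary (2 + b) = [:: b; true].
Proof. by case: b. Qed.

Section Sizes.
Variables (Var C : finType) (Gm : C -> {set {set Var * bool}}) (wt : Var * bool -> nat).
Hypothesis wt_bound : forall l, 0 < wt l <= 3.
Hypothesis wt_two : forall l, exists b : bool, wt l = 2 + b.
Hypothesis Gm_card : forall c, #|Gm c| <= 4.
Local Notation W := (gvertex Var C).

(** Every level of [enc_seq] costs its number of items times [2 * item + 1]: 3 parts, [m] vertices,
    at most 4 entries per vertex, each with a set of at most [m] unary indices and a two-bit
    weight. *)
Definition enc_bound (m : nat) :=
  3 * (2 * (m.+1 + 3 * m + m * (2 * (4 * (2 * (2 * (m * (2 * m).+1) + 3)).+1)).+1)).+1.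

Lemma size_enc_gadget : size (enc_bnsl (gadget Gm wt_bound)) <= enc_bound #|{: W}|.
Proof.
rewrite enc_fin_bnsl /enc_bound.
set m := #|{: W}|.
have h1 (w : W) : size (enc_ents (gent Gm wt w)) <=
   4 * (2 * (2 * (m * (2 * m).+1) + 3)).+1.
  apply: leq_trans (size_enc_seq_le (m := 2 * (m * (2 * m).+1) + 3) _) _.
    apply/allP => s /mapP[e he ->].
    have hb : size (enc_binary e.2) = 2.
      case: w he => [l|c] /=; first by rewrite inE => /eqP->; have [b ->] := wt_two l; case: b.
      by case/mapP => P _ ->.
    have hr : size (enc_rank_set e.1) <= m * (2 * m).+1 by apply: size_enc_rank_set.
    by rewrite size_bpair hb -mul2n leq_add2r leq_mul2l.
  rewrite leq_mul2r; apply/orP; right; rewrite size_map.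
  by case: w => [l|c] //=; rewrite size_map -cardE; apply: Gm_card.
have hVC : #|Var| + #|C| <= m by rewrite /m card_sum card_prod card_bool; lia.
apply: leq_trans (size_enc_seq_le (m := m.+1 + 3 * m + m *
  (2 * (4 * (2 * (2 * (m * (2 * m).+1) + 3)).+1)).+1) _) _; last by [].
rewrite /= !size_nseq andbT; apply/and3P; split; first by lia.
  apply: leq_trans (leq_addr _ _); rewrite addSn ltnS; apply: leq_trans (leq_addl _ _).
  by rewrite leq_mul2l.
apply: leq_trans (leq_addl _ _).
apply: leq_trans (size_enc_seq_le (m := 4 * (2 * (2 * (m * (2 * m).+1) + 3)).+1) _) _.
  by apply/allP => s /mapP[v _ ->].
by rewrite size_map size_enum_ord.
Qed.

End Sizes.

Section BlockEncodings.
Variables (n p t : nat) (G : finType) (g : G -> gate (inp n p + G)) (out : inp n p + G).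
Variable v : G -> (inp n p -> bool) -> bool.
Hypothesis v_cons : forall x, consistent g x (v^~ x).
Hypothesis v_uniq : forall x v', consistent g x v' -> v' =1 v^~ x.
Variables (s : {ffun 'I_t -> bool}) (w : 'I_t -> p.-tuple bool).
Variables (u : {ffun 'I_t * bool -> n.-tuple bool}) (k : 'I_t * bool).

Local Notation X := (n.-tuple bool).
Local Notation uy := (fun y : X => upd u k y).
Local Notation al := (fun (q : bvar n p t G) (y : X) => bassign v s w (uy y) q).

Lemma comp_bassign : comp (fun i (y : X) => tnth y i) al (t * (#|G| + 2)).
Proof.
have h j : comp (fun i (y : X) => tnth y i)
    (fun (z : inp n p + G) y => bassign v s w (uy y) (j, z)) (#|G| + 2).
  rewrite addnC.
  apply: (@comp_trans _ _ (inp n p) _ _ (fun z y => binput s w (uy y) j z)).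
    pose q (z : inp n p) : 'I_n + inp n p :=
      match z with inl (side, i) => if (j, side) == k then inl i else inr z | _ => inr z end.
    rewrite -[2]add0n.
    apply: (comp_pair (p := q) (b1 := fun i (y : X) => tnth y i)
      (b2 := fun z (_ : X) => binput s w u j z)).
    - case=> [[side i]|[i|]] y //=; rewrite /q /= ffunE.
      by case: eqP.
    - exact: (@comp_proj _ _ _ _ _ id).
    exact: (@comp_cst _ _ _ _ _ (binput s w u j)).
  apply: (@comp_pre _ _ _ _ (fun i (x : inp n p -> bool) => x i)
    (fun (z : inp n p + G) x => wval x (v^~ x) z) (fun y => binput s w (uy y) j)).
  by exists G, g, id, v.
apply: comp_le (comp_sub (p := fun q : bvar n p t G => @Tagged 'I_t q.1 (fun=> (inp n p + G)%type) q.2) _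
   (comp_sig h)).
  by rewrite sum_nat_const card_ord.
by case.
Qed.

Lemma comp_al_eq q b : comp al (fun (_ : unit) y => al q y == b) 3.
Proof.
case: b.
  by apply: comp_le (eq_comp _ (comp_in al q)) => // _ y; case: bassign.
by apply: comp_le (eq_comp _ (comp_not (comp_in al q))) => // _ y; case: bassign.
Qed.

(** Every entry of the adjacency matrix is a constant or the test of a single wire. *)
Lemma comp_bits_sol :
  comp_bits al 3 (fun y => enc_digraph (bsol g out v s w (uy y))).
Proof.
pose W := gvertex (bvar n p t G) (bcon t G).
pose b (q : 'I_#|{: W}| * 'I_#|{: W}|) (y : X) :=
  grel (bpatterns g out) (fun q => al q y) (enum_val q.1) (enum_val q.2).
apply: (@eq_comp_bits _ _ _ _ (fun y => [seq b q y | q <-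
   [seq (x, x') | x <- enum 'I_#|{: W}|, x' <- enum 'I_#|{: W}|]])).
  move=> y; rewrite map_allpairs /enc_digraph; apply: eq_allpairs => x x'.
  by rewrite inE.
apply: comp_bits_map => // -[x x']; rewrite /b /grel /=.
have cst (c : bool) : comp al (fun (_ : unit) (_ : X) => c) 3.
  by apply: comp_le (@comp_cst _ _ _ _ _ (fun=> c) _).
case: (enum_val x) => [l|c]; case: (enum_val x') => [l'|c'] //=.
- by case: (_ == _) => /=; [apply: comp_al_eq | apply: cst].
- by case: (_ \in _) => /=; [apply: comp_al_eq | apply: cst].
case: (_ \in _) => /=; last exact: cst.
by apply: eq_comp (comp_al_eq l'.1 (~~ l'.2)) => _ y; case: bassign; case: l'.2.
Qed.

Lemma comp_bits_inst :
  comp_bits al 3 (fun y => enc_bnsl (binst g out (uy y))).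
Proof.
pose W := gvertex (bvar n p t G) (bcon t G).
pose f (z : 'I_#|{: W}|) (y : X) :=
  enc_ents (gent (bpatterns g out) (bweight (uy y)) (enum_val z)).
apply: (@eq_comp_bits _ _ _ _ (fun y => bpair (enc_unary #|{: W}|)
   (bpair (enc_int_unary (Posz (3 * (#|{: bvar n p t G}| + #|{: bcon t G}|))))
     (bpair (enc_seq [seq f z y | z <- enum 'I_#|{: W}|]) [::])))).
  by move=> y; rewrite enc_fin_bnsl.
do 2!(apply: comp_bits_bpair => //; first exact: comp_bits_cst).
apply: comp_bits_bpair => //; last exact: comp_bits_cst.
apply: comp_bits_enc_seq => // z; rewrite /f; case: (enum_val z) => [l|c]; last first.
  exact: comp_bits_cst.
rewrite /enc_ents /=; apply: comp_bits_bpair => //; last exact: comp_bits_cst.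
apply: comp_bits_bpair => //; first exact: comp_bits_cst.
rewrite /bweight; case: l => -[j [[[side i]|z']|z']] b /=; try exact: comp_bits_cst.
apply: (@eq_comp_bits _ _ _ _ (fun y => [seq c || (al (j, inl (inl (side, i))) y == ~~ b)
   | c <- [:: false; true]])).
  move=> y; rewrite enc_binary_weight /= /bassign /=.
  by case: (tnth _ _); case: b.
apply: (@comp_bits_map _ _ _ _ _ (fun c y => c || (al (j, inl (inl (side, i))) y == ~~ b))) => //.
case=> /=; last exact: comp_al_eq.
by apply: comp_le (@comp_cst _ _ _ _ _ (fun=> true) _).
Qed.

End BlockEncodings.

(** * Circuits for languages in NP *)

Lemma polyboundedS f : polybounded f -> polybounded (fun n => (f n).+1).
Proof.
move=> h; apply: polybounded_le (polyboundedD h (polybounded_cst 1)) => n.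
by rewrite addn1.
Qed.

Ltac polyb :=
  lazymatch goal with
  | |- polybounded (fun _ => ?c) => exact: polybounded_cst
  | |- polybounded (fun n => n) => exact: polybounded_id
  | |- polybounded (fun n => S (@?f n)) => apply: (@polyboundedS f); polyb
  | |- polybounded (fun n => addn (@?f n) (@?h n)) => apply: (@polyboundedD f h); polyb
  | |- polybounded (fun n => muln (@?f n) (@?h n)) => apply: (@polyboundedM f h); polyb
  | |- polybounded (fun n => expn (@?f n) ?k) => apply: (@polyboundedX f k); polyb
  | |- polybounded (fun n => poly_bound ?k (@?f n)) => apply: (@polybounded_pb f k); polyb
  | |- _ => assumption
  end.

(** Witnesses of varying length become prefixes of a [p]-tuple, which gives the circuit a fixed
    number of witness inputs. *)
Definition np_rel (V : bits -> bits -> bool) n p (y : n.-tuple bool) (w : p.-tuple bool) :=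
  has (fun l => V y (take l w)) (iota 0 p.+1).

Lemma np_relP (V : bits -> bits -> bool) n p (y : n.-tuple bool) :
  (exists w : p.-tuple bool, np_rel V y w) <-> exists w, size w <= p /\ V y w.
Proof.
split=> [[w /hasP[l]]|[w [hw hV]]].
  rewrite mem_iota ltnS /= => hl h; exists (take l w); split=> //.
  by apply: leq_trans hl; rewrite size_take_min geq_minl.
have hsz : size (w ++ nseq (p - size w) false) == p.
  by rewrite size_cat size_nseq subnKC.
exists (Tuple hsz); apply/hasP; exists (size w); first by rewrite mem_iota ltnS.
by rewrite /= take_size_cat.
Qed.

Lemma verifier_circuit (V : bits -> bits -> bool) c :
  poly_time (fun _ : bits * bits => True)
    (fun xy => bpair xy.1 xy.2) (fun xy => [:: V xy.1 xy.2]) ->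
  exists2 s, polybounded s & forall n,
    comp (fun i (x : inp n (poly_bound c n) -> bool) => x i)
      (fun (_ : unit) x => np_rel V (selected x) (claimed x)) (s n).
Proof.
case/comp_poly_time => f [hf hfc].
pose N n := 2 * n + (poly_bound c n).+1.
have pN : polybounded N by rewrite /N; polyb.
exists (fun n => ((poly_bound c n).+1 * (N n * 3 * 10 + f (N n) 1).+2.+3).+2).
  apply/polyboundedS/polyboundedS/polyboundedM; first by polyb.
  do 5!apply: polyboundedS; apply: polyboundedD; first by polyb.
  by apply: (hf N (fun=> 1)); polyb.
move=> n; set p := poly_bound c n.
set a := fun i (x : inp n p -> bool) => x i.
have hl l : comp a (fun (_ : unit) x => V (selected x) (take l (claimed x)))
    (N n * 3 * 10 + f (N n) 1).+2.
  have hsel : comp_bits a 8 (fun x => val (selected x)).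
    apply: (@eq_comp_bits _ _ _ _ (fun x => [seq x (inl (x (inr None), i)) | i <- enum 'I_n])).
      by move=> x; rewrite -val_ord_tuple.
    apply: (@comp_bits_map _ _ _ _ _ (fun i x => x (inl (x (inr None), i)))) => // i.
    (* The multiplexer for the selector bit takes [2 + 3 + 3] gates, the origin of the constant
       8. *)
    apply: comp_le (eq_comp _ (comp_or
      (comp_and (comp_in a (inr None)) (comp_in a (inl (true, i))))
      (comp_and (comp_not (comp_in a (inr None))) (comp_in a (inl (false, i)))))); first by [].
    by move=> _ x; rewrite /a; case: (x (inr None)) => /=; rewrite ?orbF.
  have hcl : comp_bits a 8 (fun x => take l (claimed x)).
    apply: (@eq_comp_bits _ _ _ _ (fun x => [seq x (inr (Some i)) | i <- take l (enum 'I_p)])).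
      by move=> x; rewrite map_take -val_ord_tuple.
    apply: (@comp_bits_map _ _ _ _ _ (fun i x => x (inr (Some i)))) => // i.
    by apply: comp_le (comp_in a (inr (Some i))).
  have hs (x : inp n p -> bool) : size (bpair (selected x) (take l (claimed x))) <= N n.
    rewrite size_bpair size_tuple -mul2n /N. rewrite leq_add2l ltnS.
    by rewrite size_take_min size_tuple geq_minr.
  have he := comp_str_bits hs (comp_bits_bpair (isT : 2 <= 8) hsel hcl).
  have h1 := hfc _ _ a (fun x => (val (selected x), take l (claimed x))) (N n) 1
    _ (fun=> I) he (fun=> isT).
  apply: eq_comp (comp_str_cell 0 (Some true) h1) => _ x.
  by rewrite /cell /=; case: (V _ _).
by apply: comp_le (comp_has (iota 0 p.+1) hl); rewrite size_iota.
Qed.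

Lemma enc_bound_mono m m' : m <= m' -> enc_bound m <= enc_bound m'.
Proof. by move=> h; rewrite /enc_bound; do !(apply: leq_mul || apply: leq_add || rewrite ltnS). Qed.

(** * From the two solution transformations to circuits deciding membership *)

Section Compression.
Variable R : bnsl -> bnsl.
Variable TF : forall I, digraph I -> digraph (R I).
Variable TB : forall I, digraph (R I) -> digraph I.
Hypothesis TF_sol : forall I (D : digraph I), solution D -> solution (TF D).
Hypothesis TB_sol : forall I (D : digraph (R I)), solution D -> solution (TB D).
Variables fF fB : nat -> nat -> nat.
Hypothesis TF_comp : forall X I (a : I -> X -> bool) (u : X -> {I : bnsl & digraph I}) N N' s,
  (forall x, solution (projT2 (u x))) ->
  comp_str a (fun x => bpair (enc_bnsl (projT1 (u x))) (enc_digraph (projT2 (u x)))) N s ->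
  (forall x, size (enc_digraph (TF (projT2 (u x)))) <= N') ->
  comp_str a (fun x => enc_digraph (TF (projT2 (u x)))) N' (s + fF N N').
Hypothesis TB_comp : forall X I (a : I -> X -> bool)
    (u : X -> {I : bnsl & digraph (R I)}) N N' s,
  (forall x, solution (projT2 (u x))) ->
  comp_str a (fun x => bpair (enc_bnsl (projT1 (u x))) (enc_digraph (projT2 (u x)))) N s ->
  (forall x, size (enc_digraph (TB (projT2 (u x)))) <= N') ->
  comp_str a (fun x => enc_digraph (TB (projT2 (u x)))) N' (s + fB N N').

Variables (n p : nat) (rel : n.-tuple bool -> p.-tuple bool -> bool).
Variables (G : finType) (g : G -> gate (inp n p + G)) (out : inp n p + G).
Variable v : G -> (inp n p -> bool) -> bool.
Hypothesis v_cons : forall x, consistent g x (v^~ x).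
Hypothesis v_uniq : forall x v', consistent g x v' -> v' =1 v^~ x.
Hypothesis outP : forall x, wval x (v^~ x) out = rel (selected x) (claimed x).

Variables (B M : nat).
Hypothesis B_bound : block_size n p G <= B.
Hypothesis M_bound : forall I, lfen_superstructure I <= B ^ 2 -> nv (R I) <= M.
(** There are at most [2 ^ (M ^ 2)] digraphs on at most [M] labelled vertices, half the number of
    selection patterns. *)
Let t := (M ^ 2).+1.

Local Notation inst := (binst (t := t) g out).
Local Notation X := (n.-tuple bool).

Implicit Types (s : {ffun 'I_t -> bool}) (u : {ffun 'I_t * bool -> X}).

Definition witness (x : X) : p.-tuple bool :=
  odflt [tuple false | i < p] [pick w | rel x w].

Definition in_rel (x : X) : bool := [exists w, rel x w].

Lemma witnessP x : in_rel x -> rel x (witness x).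
Proof.
by case/existsP => w hw; rewrite /witness; case: pickP => //= /(_ w); rewrite hw.
Qed.

Definition answer s (w : {ffun 'I_t -> p.-tuple bool}) u (j : 'I_t) : bool :=
  selection (TB (TF (bsol g out v s w u))) j.

Lemma nv_R u : nv (R (inst u)) <= M.
Proof.
apply: M_bound; apply: leq_trans (binst_lfen g out u) _.
exact: leq_expr.
Qed.

(** The round trip returns some solution of the same instance, and every solution contains a witness
    for the string selected in each block, however it relates to the digraph put in. *)
Lemma answer_sound s (w : {ffun 'I_t -> p.-tuple bool}) u : (forall j, rel (u (j, s j)) (w j)) ->
  forall j, in_rel (u (j, answer s w u j)).
Proof.
move=> h j; apply/existsP; apply: (binst_sound v_uniq outP).
exact/TB_sol/TF_sol/(bsol_solution v_cons outP).
Qed.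

Lemma card_digraph (I : bnsl) : #|{: digraph I}| = 2 ^ (nv I ^ 2).
Proof.
by rewrite -cardsT -powersetT card_powerset cardsT card_prod card_ord mulnn.
Qed.

(** The instance depends on [u] only, so [s] and the witnesses influence the answer solely through
    the digraph on the output instance. *)
Lemma answer_image u (w : {ffun 'I_t -> bool} -> {ffun 'I_t -> p.-tuple bool}) :
  #|[set [ffun j => answer s (w s) u j] | s : {ffun 'I_t -> bool}]| <= 2 ^ (M ^ 2).
Proof.
apply: (@leq_trans #|[set [ffun j => selection (TB D) j] | D : digraph (R (inst u))]|).
  apply: subset_leq_card; apply/subsetP => f /imsetP[s _ ->]; apply/imsetP.
  by exists (TF (bsol g out v s (w s) u)).
apply: leq_trans (leq_imset_card _ _) _; rewrite card_digraph.
by rewrite leq_exp2l // leq_expr // nv_R.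
Qed.

Definition vertex_bound := t * B.
Definition input_bound := (2 * enc_bound vertex_bound + (vertex_bound ^ 2).+1).
Definition relay_bound := (2 * enc_bound vertex_bound + (M ^ 2).+1).
Definition answer_cost (m : nat) :=
  t * (m + 2) +
  (relay_bound * 3 * 5 + (input_bound * 3 * 5 + fF input_bound (M ^ 2)).+2 + fB relay_bound (vertex_bound ^ 2)).+2.

Lemma comp_answer s (w : {ffun 'I_t -> p.-tuple bool}) u k i b : (forall y j, rel (upd u k y (j, s j)) (w j)) ->
  comp (fun i (y : X) => tnth y i)
    (fun (_ : unit) y => answer s w (upd u k y) i == b) (answer_cost #|G|).
Proof.
move=> hrel; apply: comp_trans (comp_bassign v_cons v_uniq s w u k) _.
set al := fun (q : bvar n p t G) (y : X) => _.
pose I y := inst (upd u k y); pose D y : digraph (I y) := bsol g out v s w (upd u k y).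
have nvI y : nv (I y) <= vertex_bound.
  by rewrite /I /= card_bvertex leq_mul2l B_bound orbT.
have sI y : size (enc_bnsl (I y)) <= enc_bound vertex_bound.
  apply: leq_trans (size_enc_gadget _ _ _) _.
  - case=> -[j z] c; rewrite /bweight /=.
    by case: z => [[[side i']|z]|z] /=; [eexists | exists true | exists true].
  - case=> j [z|]; rewrite /bpatterns /=; first exact: card_gate_patterns.
    by rewrite cards1.
  by apply: enc_bound_mono; exact: nvI.
have hD y : solution (D y) by apply: (bsol_solution v_cons outP).
have sD y : size (enc_digraph (D y)) <= vertex_bound ^ 2.
  by rewrite size_enc_digraph leq_expr // nvI.
have bD : comp_bits al 3 (fun y => enc_digraph (D y)) by apply: comp_bits_sol.
have bI : comp_bits al 3 (fun y => enc_bnsl (I y)) by apply: comp_bits_inst.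
have h1 : comp_str al (fun y => bpair (enc_bnsl (I y)) (enc_digraph (D y))) input_bound (input_bound * 3 * 5).
  apply: comp_str_bits; last exact: comp_bits_bpair.
  by move=> y; rewrite size_bpair -mul2n /input_bound; have := sI y; have := sD y; lia.
have h2 := TF_comp (u := fun y => existT _ (I y) (D y)) (N' := M ^ 2) hD h1.
have {}h2 := h2 (fun y => ltac:(by rewrite size_enc_digraph leq_expr // nv_R)).
have h3 : comp_str al (fun y => bpair (enc_bnsl (I y)) (enc_digraph (TF (D y)))) relay_bound
    (relay_bound * 3 * 5 + (input_bound * 3 * 5 + fF input_bound (M ^ 2)).+2).
  apply: comp_str_bpair h2 _ => // y; rewrite size_bpair -mul2n /relay_bound.
  by rewrite leq_add ?ltnS ?leq_mul2l ?sI ?orbT // size_enc_digraph leq_expr // nv_R.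
have h4 := TB_comp (u := fun y => existT (fun I => digraph (R I)) (I y) (TF (D y)))
  (N' := vertex_bound ^ 2) (fun y => TF_sol (hD y)) h3.
have {}h4 := h4 (fun y => ltac:(by rewrite size_enc_digraph leq_expr // nvI)).
(* The answer is one entry of the adjacency matrix: the arc between the two literals of the selector
   of block [i]. *)
pose l0 c : gvertex (bvar n p t G) (bcon t G) := inl ((i, inl (inr None)), c).
apply: eq_comp (comp_str_cell (enum_rank (l0 true) * #|{: gvertex (bvar n p t G) (bcon t G)}|
  + enum_rank (l0 false)) (Some b) h4) => _ y.
rewrite cellE /= size_enc_digraph.
rewrite (@fin_nth_digraph _ _ _ _ _ (TB (TF (D y))) (l0 true) (l0 false)).
case: ltnP => [_|]; first by rewrite /answer /selection /assignment_of; case: arc; case: b.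
rewrite leqNgt => /negP[].
have := ltn_ord (enum_rank (l0 true)); have := ltn_ord (enum_rank (l0 false)).
rewrite -mulnn /=; set m := #|_|; nia.
Qed.

Lemma exists_test (Y : {set X}) : Y \subset [set x | in_rel x] -> Y != set0 ->
  exists2 T : X -> bool,
    comp (fun i (y : X) => tnth y i) (fun _ : unit => T) (answer_cost #|G|) /\
      (forall y, T y -> in_rel y) &
    #|Y| <= 2 * t * #|[set y in Y | T y]|.
Proof.
move=> YS Yn.
(* All filler strings are drawn from [Y], so each has a witness whichever slot is selected, and the
   hitting bound counts elements of [Y] itself. *)
pose YT := {y | y \in Y}.
pose ex (u : {ffun 'I_t * bool -> YT}) : {ffun 'I_t * bool -> X} := [ffun k => val (u k)].
pose wit u s : {ffun 'I_t -> p.-tuple bool} := [ffun j => witness (u (j, s j))].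
pose Gm (u : {ffun 'I_t * bool -> YT}) s : {ffun 'I_t -> bool} := [ffun j => answer s (wit (ex u) s) (ex u) j].
have cY : #|{: YT}| = #|Y| by rewrite card_sig; apply: eq_card => y; rewrite inE.
have hY : 0 < #|{: YT}| by rewrite cY card_gt0.
have hG (u : {ffun 'I_t * bool -> YT}) : #|[set Gm u s | s : {ffun 'I_t -> bool}]| <= 2 ^ (M ^ 2).
  exact: answer_image.
have [u [s [i h]]] := exists_hitting_test (leqnn _) hG hY.
(* The tested string goes into the slot of block [i] that [s] does not select, so the fixed
   witnesses remain valid for every [y]; the test accepts when the answer for block [i] flips to
   that slot. *)
pose k := (i, ~~ s i).
have hk y j : upd (ex u) k y (j, s j) = ex u (j, s j).
  by rewrite ffunE /k xpair_eqE; case: eqP => //= ->; case: (s i).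
have hrel y j : rel (upd (ex u) k y (j, s j)) (wit (ex u) s j).
  rewrite hk /wit [X in rel _ X]ffunE; apply: witnessP; rewrite ffunE.
  by have := subsetP YS _ (valP (u (j, s j))); rewrite inE.
exists (fun y => answer s (wit (ex u) s) (upd (ex u) k y) i == ~~ s i); first split.
- exact: comp_answer.
- move=> y /eqP e; have := answer_sound (hrel y) i.
  by rewrite e /upd ffunE eqxx.
rewrite -cY; apply: leq_trans h _; rewrite leq_mul2l; apply/orP; right.
rewrite -(card_imset _ val_inj); apply: subset_leq_card; apply/subsetP => y.
case/imsetP => y' + ->; rewrite !inE (valP y') /= => hy.
have e : ex (upd u k y') = upd (ex u) k (val y').
  by apply/ffunP => k'; rewrite !ffunE; case: eqP.
move: hy; rewrite /Gm ffunE e -/k.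
have -> : wit (upd (ex u) k (val y')) s = wit (ex u) s.
  by apply/ffunP => j; rewrite [LHS]ffunE [RHS]ffunE hk.
by case: answer; case: (s i).
Qed.

(** There are [n + 1] halvings of [2 * t] tests each; since the tests are sound, their disjunction
    is exactly membership. *)
Lemma comp_in_rel :
  comp (fun i (y : X) => tnth y i) (fun _ : unit => in_rel)
    (2 * t * n.+1 * (answer_cost #|G|).+3).+2.
Proof.
have hS : #|[set x | in_rel x]| < 2 ^ n.+1.
  apply: (@leq_ltn_trans (2 ^ n)); last by rewrite ltn_exp2l.
  by apply: leq_trans (max_card _) _; rewrite card_tuple card_bool.
have [ts hts h] := cover_by_tests exists_test (subxx _) hS.
apply: comp_le (eq_comp _ (comp_has ts (fun T => (svalP T).1))).
  by rewrite !ltnS leq_mul2r hts orbT.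
move=> _ y; apply/idP/idP => [hy|]; first by apply: h; rewrite inE.
by elim: ts {hts h} => //= T ts IH /orP[/(svalP T).2|].
Qed.

End Compression.

Lemma polybounded_enc_bound f : polybounded f -> polybounded (fun n => enc_bound (f n)).
Proof. by move=> hf; rewrite /enc_bound; polyb. Qed.

Lemma compression_collapse (R : bnsl -> bnsl) c :
  forward_transformable R -> backward_transformable R ->
  (forall I, nv (R I) <= poly_bound c (lfen_superstructure I)) -> NP_sub_coNP_poly.
Proof.
move=> [TF [/comp_poly_time[fF [hfF cF]] sF]] [TB [/comp_poly_time[fB [hfB cB]] sB]] hR.
move=> L [V [d [/verifier_circuit-/(_ d)[s hs cs] hL]]].
pose p n := poly_bound d n.
pose B n := 2 * ((2 * n + (p n).+1) + s n) + (s n).+1.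
(* [B] bounds the size of a block and [B ^ 2] its local feedback edge number, so this vertex bound
   depends on [n] alone and not on the number of copies. *)
pose M n := poly_bound c (B n ^ 2).
have pp : polybounded p by rewrite /p; polyb.
have pB : polybounded B by rewrite /B; polyb.
have pM : polybounded M by rewrite /M; polyb.
have pW : polybounded (fun n => vertex_bound (B n) (M n)) by rewrite /vertex_bound; polyb.
have pE := polybounded_enc_bound pW.
have pI : polybounded (fun n => input_bound (B n) (M n)) by rewrite /input_bound; polyb.
have pR : polybounded (fun n => relay_bound (B n) (M n)) by rewrite /relay_bound; polyb.
have pM2 : polybounded (fun n => M n ^ 2) by polyb.
have pW2 : polybounded (fun n => vertex_bound (B n) (M n) ^ 2) by polyb.
have pF := hfF _ _ pI pM2; have pG := hfB _ _ pR pW2.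
apply: (@circuits_in_coNP_poly L (fun n => (2 * (M n ^ 2).+1 * n.+1 *
  (answer_cost fF fB (B n) (M n) (s n)).+3).+2)).
  by rewrite /answer_cost; polyb.
move=> n; have [G [g [o [v [h1 h2 h3 h4]]]]] := cs n.
exists (in_rel (@np_rel V n (p n))); last first.
  move=> x; rewrite hL size_tuple -np_relP; split=> [[w hw]|/existsP[w hw]]; last by exists w.
  by apply/existsP; exists w.
have hB : block_size n (p n) G <= B n.
  rewrite /block_size /B; have -> : #|{: inp n (p n)}| = 2 * n + (p n).+1.
    by rewrite card_sum card_prod card_bool card_option !card_ord.
  by lia.
have hM I : lfen_superstructure I <= B n ^ 2 -> nv (R I) <= M n.
  by move=> h; apply: leq_trans (hR I) _; apply: poly_bound_mono.
apply: comp_le (@comp_in_rel R TF TB sF sB fF fB cF cB n (p n) (@np_rel V n (p n)) G g (o tt) v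
  h2 h3 (fun x => esym (h4 tt x)) (B n) (M n) hB hM).
have hG : answer_cost fF fB (B n) (M n) #|G| <= answer_cost fF fB (B n) (M n) (s n).
  by rewrite /answer_cost leq_add2r leq_mul2l leq_add2r h1 orbT.
by rewrite 2!ltnS leq_mul2l 3!ltnS hG orbT.
Qed.

Theorem theorem5 (hNP : ~ NP_sub_coNP_poly) :
  (~ exists R : bnsl -> bnsl,
       [/\ poly_time_bnsl R,
           outputs_equivalent R &
           exists c : nat, forall I : bnsl,
             nv (R I) <= poly_bound c (lfen_superstructure I)]) /\
  (~ exists R : bnsl -> bnsl, polynomial_kernel lfen_superstructure R).
Proof.
split=> -[R [_ [_ hF hB] [c hc]]]; apply: hNP; apply: (compression_collapse hF hB (c := c)) => //.
move=> I; apply: leq_trans (hc I); rewrite /bnsl_size -addnA; exact: leq_addr.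
Qed.
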